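(* Consider non-unital qubit channels $\Lambda$ with rank-four Choi state for which the final state $\rho^f=(\mathbf I\otimes\Lambda)(|\Phi_1\rangle\langle\Phi_1|)$, obtained by sending one half of the Bell state $|\Phi_1\rangle=\frac{1}{\sqrt2}(|00\rangle+|11\rangle)$ through $\Lambda$, is useful for universal quantum teleportation (UQT), where without loss of generality $\rho^f$ is taken in its canonical representation $$\rho^f=\tfrac14\Bigl[\mathbf I_4+\mathbf I_2\otimes\boldsymbol s\cdot\boldsymbol\sigma-t\sum_{i=1}^3\sigma_i\otimes\sigma_i\Bigr].$$ Any such channel belongs to the set of channels with the following four orthogonal Kraus operators (written in the basis $\{|0\rangle,|1\rangle\}$), where $\boldsymbol s=(s_1,s_2,s_3)\in\mathbb R^3$, $s=|\boldsymbol s|=\sqrt{s_1^2+s_2^2+s_3^2}$, $\frac13<t<1$, $0<s<1-t$ and $R=\sqrt{s^2+4t^2}$: $$K_0=x_0\begin{pmatrix}\dfrac{is_1+s_2}{s_3-2t-R}&\dfrac{i(s^2+s_3(s_3+2R))}{s^2-s_3^2+4s_3t}\\[2mm]-i&\dfrac{is_1-s_2}{-s_3+2t+R}\end{pmatrix},\quad K_1=x_1\begin{pmatrix}\dfrac{-i(s+s_3)}{s_1+is_2}&-i\\[2mm]-i&\dfrac{i(s_3-s)}{s_1-is_2}\end{pmatrix},$$ $$K_2=x_2\begin{pmatrix}\dfrac{is_1+s_2}{s_3-2t+R}&\dfrac{i(s^2+s_3(s_3-2R))}{s^2-s_3^2+4s_3t}\\[2mm]-i&\dfrac{-is_1+s_2}{s_3-2t+R}\end{pmatrix},\quad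 K_3=x_3\begin{pmatrix}\dfrac{is_1+s_2}{s+s_3}&-i\\[2mm]-i&\dfrac{i(s+s_3)}{s_1-is_2}\end{pmatrix},$$ with $$x_0=\frac{2t-s_3+R}{2\sqrt2}\sqrt{\frac{1+t+R}{s^2+2t(2t+R)}},\qquad x_1=\frac{1}{2\sqrt2}\frac{\sqrt{(s^2-s_3^2)(1+s-t)}}{s},$$ $$x_2=\frac{s_3-2t+R}{2\sqrt2}\sqrt{\frac{1+t-R}{s^2+2t(2t-R)}},\qquad x_3=\frac{1}{2\sqrt2}\frac{\sqrt{(s^2-s_3^2)(1-s-t)}}{s}.$$ These Kraus operators satisfy $\sum_{i=0}^3K_i^\dagger K_i=\mathbf I_2$, the associated Choi states are non-negative (so they represent completely positive trace-preserving maps), and $\sum_{i=0}^3K_iK_i^\dagger\neq\mathbf I_2$ as long as $|\boldsymbol s|>0$.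
   Context: A qubit channel is a completely positive trace-preserving linear map $\Lambda(\chi)=\sum_iK_i\chi K_i^\dagger$ on $2\times2$ complex matrices; it is unital if $\Lambda(\mathbf I_2)=\mathbf I_2$ and non-unital otherwise. Kraus operators are not unique: sets of Kraus operators related by a unitary mixing $\tilde K_i=\sum_jW_{ij}K_j$ define the same channel. Kraus operators are called orthogonal if $\mathrm{Tr}(K_i^\dagger K_j)=0$ for $i\neq j$. The Choi state of $\Lambda$ is $(\mathbf I\otimes\Lambda)(|\Phi_1\rangle\langle\Phi_1|)$. Here $\boldsymbol\sigma=(\sigma_1,\sigma_2,\sigma_3)$ are the Pauli matrices. Useful for UQT. For a two-qubit density matrix $\rho$ let $T_\rho$ be the real $3\times3$ matrix with entries $T_{ij}=\mathrm{Tr}(\rho\,\sigma_i\otimes\sigma_j)$. By local unitaries $\rho$ can be brought to a canonical form $\rho_C$ whose correlation matrix is diagonal with entries $\lambda_k|t_{kk}|$, $\lambda_k\in\{-1,+1\}$, $k=1,2,3$; if $\det T_\rho\le0$ one can take $\lambda_k=-1$ for all $k$ with $|t_{kk}|\neq0$. The maximal average fidelity $F_\rho$ is the teleportation fidelity averaged over uniformly distributed pure qubit inputs in the standard teleportation protocol, maximized over local unitaries (the maximum is attained by $\rho_C$). The fidelity deviation $\Delta_\rho$ is the standard deviation of the fidelity over the inputs when $\rho_C$ is used. The state $\rho$ is useful for UQT if $F_\rho>\frac23$ and $\Delta_\rho=0$. States with $F_\rho>\frac23$ satisfy $\det T_\rho<0$, and for states with $\det T_\rho<0$ one has $F_\rho=\frac12\bigl(1+\frac13\sum_i|t_{ii}|\bigr)$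 and $\Delta_\rho=\frac{1}{3\sqrt{10}}\sqrt{\sum_{i<j}(|t_{ii}|-|t_{jj}|)^2}$, so that such a state is useful for UQT exactly when $|t_{11}|=|t_{22}|=|t_{33}|>\frac13$.
   Formalization: The printed Kraus operators have zero denominators when s_1=s_2=0 or s^2-s_3^2+4s_3t=0, so claims using them exclude these parameters; every channel of the class is still covered, since its canonical representation can be chosen to avoid them. *)

(* Defs.v *)
From mathcomp Require Import all_boot all_order all_algebra.
From mathcomp Require Import complex mxtens.
From mathcomp Require Import all_classical all_reals all_analysis.

Set Implicit Arguments.
Unset Strict Implicit.
Unset Printing Implicit Defensive.

Import Order.TTheory GRing.Theory Num.Theory.
Import numFieldNormedType.Exports.

Local Open Scope classical_set_scope.
Local Open Scope ring_scope.
Local Open Scope complex_scope.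
Local Open Scope sesquilinear_scope.

Section Defs.
Variable R : realType.
Local Notation C := R[i].

Definition psd n (A : 'M[C]_n) : Prop :=
  forall v : 'cV[C]_n, 0 <= (v^t* *m A *m v) ord0 ord0.

Definition mx2 (a b c d : C) : 'M[C]_2 :=
  \matrix_(i, j) nth 0 (nth [::] [:: [:: a; b]; [:: c; d]] i) j.

(* pauli 0 is the identity and pauli 1, pauli 2, pauli 3 are the Pauli
   matrices; sigma i, with i : 'I_3, is the i.+1-st Pauli matrix. *)
Definition pauli (k : 'I_4) : 'M[C]_2 :=
  nth 0 [:: 1%:M; mx2 0 1 1 0; mx2 0 (- 'i) 'i 0; mx2 1 0 0 (- 1)] k.

Definition sigma (i : 'I_3) : 'M[C]_2 := pauli (lift ord0 i).

Definition ket (i : 'I_2) : 'cV[C]_2 := delta_mx i 0.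

Definition Phi1 : 'cV[C]_(2 * 2) :=
  (Num.sqrt 2)^-1%:C *: (ket 0 *t ket 0 + ket 1 *t ket 1).

Definition PsiMinus : 'cV[C]_(2 * 2) :=
  (Num.sqrt 2)^-1%:C *: (ket 0 *t ket 1 - ket 1 *t ket 0).

(* I_n (x) L, with L applied to each 2 x 2 block. *)
Definition id_tens n (L : 'M[C]_2 -> 'M[C]_2) (X : 'M[C]_(n * 2)) :
    'M[C]_(n * 2) :=
  \sum_(i < n) \sum_(j < n) delta_mx i j *t
    L (\matrix_(a, b) X (mxtens_index (i, a)) (mxtens_index (j, b))).

Definition completely_positive (L : 'M[C]_2 -> 'M[C]_2) : Prop :=
  forall n (X : 'M[C]_(n * 2)), psd X -> psd (id_tens L X).

Definition trace_preserving (L : 'M[C]_2 -> 'M[C]_2) : Prop :=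
  forall X, \tr (L X) = \tr X.

Definition qubit_channel (L : {linear 'M[C]_2 -> 'M[C]_2}) : Prop :=
  completely_positive L /\ trace_preserving L.

Definition unital (L : 'M[C]_2 -> 'M[C]_2) : Prop := L 1%:M = 1%:M.

Definition choi (L : 'M[C]_2 -> 'M[C]_2) : 'M[C]_(2 * 2) :=
  id_tens L (Phi1 *m Phi1^t*).

Definition kraus_map (K : 'I_4 -> 'M[C]_2) (X : 'M[C]_2) : 'M[C]_2 :=
  \sum_i K i *m X *m (K i)^t*.

Definition local_unitary (U V : 'M[C]_2) (rho : 'M[C]_(2 * 2)) :
    'M[C]_(2 * 2) :=
  (U *t V) *m rho *m (U *t V)^t*.

Definition correlation (rho : 'M[C]_(2 * 2)) : 'M[R]_3 :=
  \matrix_(i, j) complex.Re (\tr (rho *m (sigma i *t sigma j))).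

Definition bell (k : 'I_4) : 'cV[C]_(2 * 2) := (pauli k *t 1%:M) *m PsiMinus.

(* (<bell k| (x) I) (psi (x) I (x) I): Alice holds the input psi and the first
   half of the resource, and finds outcome k in the Bell measurement. *)
Definition bob_op (psi : 'cV[C]_2) (k : 'I_4) : 'M[C]_(2, 2 * 2) :=
  ((bell k)^t* *t (1%:M : 'M[C]_2)) *m (psi *t (1%:M : 'M[C]_(2 * 2))).

(* Output state, averaged over the outcomes: bob_op psi k *m rho *m _ is Bob's
   conditional state times the probability of the outcome k. The reference
   state is the singlet (outcome 0 needs no correction), which is the choice
   for which the canonical form, with correlation matrix of nonpositive
   diagonal entries, attains the maximal average fidelity. *)
Definition teleport (rho : 'M[C]_(2 * 2)) (psi : 'cV[C]_2) : 'M[C]_2 :=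
  \sum_k pauli k *m (bob_op psi k *m rho *m (bob_op psi k)^t*) *m (pauli k)^t*.

Definition fidelity (rho : 'M[C]_(2 * 2)) (psi : 'cV[C]_2) : R :=
  complex.Re ((psi^t* *m teleport rho psi *m psi) ord0 ord0).

Definition bloch (theta phi : R) : 'cV[C]_2 :=
  (cos (theta / 2))%:C *: ket 0 +
  ((cos phi +i* sin phi) * (sin (theta / 2))%:C) *: ket 1.

(* Average over the Bloch sphere with its uniform probability measure. *)
Definition pure_average (g : 'cV[C]_2 -> R) : R :=
  (4 * pi)^-1 *
  \int[lebesgue_measure]_(phi in `[0, 2 * pi])
    \int[lebesgue_measure]_(theta in `[0, pi])
      (g (bloch theta phi) * sin theta).

Definition average_fidelity (rho : 'M[C]_(2 * 2)) : R :=
  pure_average (fidelity rho).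

Definition max_average_fidelity (rho : 'M[C]_(2 * 2)) : R :=
  sup [set f | exists U V : 'M[C]_2,
    [/\ U \is unitarymx, V \is unitarymx &
        f = average_fidelity (local_unitary U V rho)]].

(* When the determinant is positive, the signs of the diagonal entries are
   those for which the maximal average fidelity is attained. *)
Definition canonical_form (rho rhoC : 'M[C]_(2 * 2)) : Prop :=
  [/\ exists U V : 'M[C]_2,
        [/\ U \is unitarymx, V \is unitarymx & rhoC = local_unitary U V rho],
      is_diag_mx (correlation rhoC),
      \det (correlation rho) <= 0 -> forall k, correlation rhoC k k <= 0 &
      0 < \det (correlation rho) ->
        average_fidelity rhoC = max_average_fidelity rho].

Definition fidelity_std (rho : 'M[C]_(2 * 2)) : R :=
  Num.sqrt (pure_average
    (fun psi => (fidelity rho psi - average_fidelity rho) ^+ 2)).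

Definition is_fidelity_deviation (rho : 'M[C]_(2 * 2)) (delta : R) : Prop :=
  exists2 rhoC, canonical_form rho rhoC & delta = fidelity_std rhoC.

Definition useful_for_UQT (rho : 'M[C]_(2 * 2)) : Prop :=
  2 / 3 < max_average_fidelity rho /\ is_fidelity_deviation rho 0.

(* The Euclidean norm; the library norm of a row vector is the sup norm. *)
Definition enorm (s : 'rV[R]_3) : R := Num.sqrt (\sum_i s 0 i ^+ 2).

(* The entries s_1, s_2, s_3 are s 0 0, s 0 1, s 0 2. *)
Definition canonical_state (s : 'rV[R]_3) (t : R) : 'M[C]_(2 * 2) :=
  (4^-1 : R)%:C *:
  (1%:M + (1%:M : 'M[C]_2) *t (\sum_i (s 0 i)%:C *: sigma i)
    - t%:C *: \sum_i sigma i *t sigma i).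

Definition admissible (s : 'rV[R]_3) (t : R) : Prop :=
  [/\ 1 / 3 < t, t < 1, 0 < enorm s & enorm s < 1 - t].

(* For 0 < t and s != 0, exactly the condition that no denominator vanishes in
   kraus s t. Elsewhere division by zero would give meaningless entries. *)
Definition generic (s : 'rV[R]_3) (t : R) : Prop :=
  (s 0 0 != 0) || (s 0 1 != 0) /\
  enorm s ^+ 2 - s 0 2 ^+ 2 + 4 * s 0 2 * t != 0.

Definition kraus (s : 'rV[R]_3) (t : R) (k : 'I_4) : 'M[C]_2 :=
  let n : R := enorm s in
  let r : R := Num.sqrt (n ^+ 2 + 4 * t ^+ 2) in
  let q : R := 2 * Num.sqrt 2 in
  let x0 : R := (2 * t - s 0 2 + r) / q *
    Num.sqrt ((1 + t + r) / (n ^+ 2 + 2 * t * (2 * t + r))) in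
  let x1 : R := q^-1 *
    (Num.sqrt ((n ^+ 2 - s 0 2 ^+ 2) * (1 + n - t)) / n) in
  let x2 : R := (s 0 2 - 2 * t + r) / q *
    Num.sqrt ((1 + t - r) / (n ^+ 2 + 2 * t * (2 * t - r))) in
  let x3 : R := q^-1 *
    (Num.sqrt ((n ^+ 2 - s 0 2 ^+ 2) * (1 - n - t)) / n) in
  let d : R := n ^+ 2 - s 0 2 ^+ 2 + 4 * s 0 2 * t in
  let s1 : C := (s 0 0)%:C in
  let s2 : C := (s 0 1)%:C in
  let s3 : C := (s 0 2)%:C in
  let t' : C := t%:C in
  let n' : C := n%:C in
  let r' : C := r%:C in
  let d' : C := d%:C in
  nth 0
    [:: x0%:C *: mx2 (('i * s1 + s2) / (s3 - 2 * t' - r'))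
                     ('i * (n' ^+ 2 + s3 * (s3 + 2 * r')) / d')
                     (- 'i)
                     (('i * s1 - s2) / (- s3 + 2 * t' + r'));
        x1%:C *: mx2 (- 'i * (n' + s3) / (s1 + 'i * s2))
                     (- 'i)
                     (- 'i)
                     ('i * (s3 - n') / (s1 - 'i * s2));
        x2%:C *: mx2 (('i * s1 + s2) / (s3 - 2 * t' + r'))
                     ('i * (n' ^+ 2 + s3 * (s3 - 2 * r')) / d')
                     (- 'i)
                     ((- 'i * s1 + s2) / (s3 - 2 * t' + r'));
        x3%:C *: mx2 (('i * s1 + s2) / (n' + s3))
                     (- 'i)
                     (- 'i)
                     ('i * (n' + s3) / (s1 - 'i * s2))] k.

(* The channel whose Choi state is the one of L rotated by U (x) V:
   choi (rotate U V L) = local_unitary U V (choi L), because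
   (U (x) I) Phi1 = (I (x) U^T) Phi1. *)
Definition rotate (U V : 'M[C]_2) (L : 'M[C]_2 -> 'M[C]_2) (X : 'M[C]_2) :
    'M[C]_2 :=
  V *m L (U^T *m X *m U^T^t*) *m V^t*.

Definition nonunital_rank4_UQT (L : {linear 'M[C]_2 -> 'M[C]_2}) : Prop :=
  [/\ qubit_channel L, ~ unital L, \rank (choi L) = 4%N &
      useful_for_UQT (choi L)].

End Defs.

(* Main.v *)
Require Import Defs.
From HB Require Import structures.
From mathcomp Require Import all_boot all_order all_algebra.
From mathcomp Require Import complex mxtens ring lra.
From mathcomp Require Import all_classical all_reals all_analysis.

(** A channel is determined by its Choi state, and rotating the Choi state by
    local unitaries amounts to composing the channel with unitary conjugations;
    so everything reduces to the two-qubit state.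

    Averaging over the Bell outcomes twirls the resource state: the fidelity for
    an input with Bloch vector n is (1 - sum_i T_ii n_i^2) / 2.  Integrating over
    the sphere, a vanishing deviation forces T_11 = T_22 = T_33 = - t for the
    canonical form.  Local unitaries act on the correlation matrix through rows
    of unit length, so a maximal average fidelity above 2/3 gives |t| > 1/3, and
    positivity on the singlet excludes t < - 1/3.  As trace preservation kills
    the first marginal, the state is then canonical_state s t for some s, and a
    rotation W (x) W, under which sum_i sigma_i (x) sigma_i is invariant, makes s
    generic.  If (s . sigma) e = - |s| e, then e (x) e is an eigenvector of the
    state for the eigenvalue (1 - t - |s|) / 4, whence |s| < 1 - t by rank four.

    The Kraus operators are rescaled by (rationalised) scalars to polynomial
    matrices, for which orthogonality and the comparison of Choi states are
    polynomial identities. *)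

Set Implicit Arguments.
Unset Strict Implicit.
Unset Printing Implicit Defensive.

Import Order.TTheory GRing.Theory Num.Theory.
Import numFieldNormedType.Exports.

Local Open Scope ring_scope.
Local Open Scope complex_scope.
Local Open Scope sesquilinear_scope.

Local Notation Re := complex.Re.
Local Notation Im := complex.Im.

(** * Two-by-two and tensor product matrices *)

Section Toolkit.
Variable R : realType.
Local Notation C := R[i].

Lemma complex_ext (x y : C) : Re x = Re y -> Im x = Im y -> x = y.
Proof. by case: x y => [a b] [c d] /= -> ->. Qed.

Lemma cReD (x y : C) : Re (x + y) = Re x + Re y.
Proof. by case: x y => [? ?] [? ?]. Qed.
Lemma cImD (x y : C) : Im (x + y) = Im x + Im y.
Proof. by case: x y => [? ?] [? ?]. Qed.
Lemma cReN (x : C) : Re (- x) = - Re x. Proof. by case: x. Qed.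
Lemma cImN (x : C) : Im (- x) = - Im x. Proof. by case: x. Qed.
Lemma cReM (x y : C) : Re (x * y) = Re x * Re y - Im x * Im y.
Proof. by case: x y => [? ?] [? ?]. Qed.
Lemma cImM (x y : C) : Im (x * y) = Re x * Im y + Im x * Re y.
Proof. by case: x y => [? ?] [? ?]. Qed.
Lemma cReJ (x : C) : Re (x^*)%R = Re x. Proof. by case: x. Qed.
Lemma cImJ (x : C) : Im (x^*)%R = - Im x. Proof. by case: x. Qed.
Lemma cRe0 : Re (0 : C) = 0. Proof. by []. Qed.
Lemma cIm0 : Im (0 : C) = 0. Proof. by []. Qed.
Lemma cRe1 : Re (1 : C) = 1. Proof. by []. Qed.
Lemma cIm1 : Im (1 : C) = 0. Proof. by []. Qed.

Definition ReIm := (cReD, cImD, cReN, cImN, cReM, cImM, cReJ, cImJ, cRe0, cIm0, cRe1, cIm1).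

Lemma realcD (x y : R) : (x + y)%:C = x%:C + y%:C :> C. Proof. exact: rmorphD. Qed.
Lemma realcN (x : R) : (- x)%:C = - x%:C :> C. Proof. exact: rmorphN. Qed.
Lemma realcM (x y : R) : (x * y)%:C = x%:C * y%:C :> C. Proof. exact: rmorphM. Qed.
Lemma realcX (x : R) k : (x ^+ k)%:C = x%:C ^+ k :> C. Proof. exact: rmorphXn. Qed.
Lemma realc_nat k : (k%:R : R)%:C = k%:R :> C. Proof. exact: rmorph_nat. Qed.
Lemma realcV (x : R) : (x^-1)%:C = x%:C^-1 :> C. Proof. exact: fmorphV. Qed.
Lemma realc_eq0 (x : R) : (x%:C == 0 :> C) = (x == 0). Proof. exact: fmorph_eq0. Qed.
Definition realcE := (realcD, realcN, realcM, realcX, realcV, realc_nat).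

Definition idx (i a : 'I_2) : 'I_(2 * 2) := mxtens_index (i, a).

Lemma sum2E (V : nmodType) (F : 'I_2 -> V) : \sum_i F i = F 0 + F 1.
Proof. by rewrite !big_ord_recl big_ord0 addr0; congr (_ + F _); by apply: val_inj. Qed.

Lemma sum3E (V : nmodType) (F : 'I_3 -> V) : \sum_i F i = F 0 + F 1 + F 2.
Proof.
rewrite !big_ord_recl big_ord0 addr0 addrA.
by congr (_ + F _ + F _); by apply: val_inj; reflexivity.
Qed.

Lemma sum4E (V : nmodType) (F : 'I_4 -> V) : \sum_i F i = F 0 + F 1 + F 2 + F 3.
Proof.
rewrite !big_ord_recl big_ord0 addr0 !addrA.
by congr (_ + F _ + F _ + F _); by apply: val_inj; reflexivity.
Qed.

Lemma ord2P (P : 'I_2 -> Prop) : P 0 -> P 1 -> forall i, P i.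
Proof.
move=> P0 P1 [[|[|k]] H] //.
- by have -> : Ordinal H = 0 by exact: val_inj.
- by have -> : Ordinal H = 1 by exact: val_inj.
Qed.

Lemma ord3P (P : 'I_3 -> Prop) : P 0 -> P 1 -> P 2 -> forall i, P i.
Proof.
move=> P0 P1 P2 [[|[|[|k]]] H] //.
- by have -> : Ordinal H = 0 by exact: val_inj.
- by have -> : Ordinal H = 1 by exact: val_inj.
- by have -> : Ordinal H = 2 by exact: val_inj.
Qed.

Lemma ord4P (P : 'I_4 -> Prop) : P 0 -> P 1 -> P 2 -> P 3 -> forall i, P i.
Proof.
move=> P0 P1 P2 P3 [[|[|[|[|k]]]] H] //.
- by have -> : Ordinal H = 0 by exact: val_inj.
- by have -> : Ordinal H = 1 by exact: val_inj.
- by have -> : Ordinal H = 2 by exact: val_inj.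
- by have -> : Ordinal H = 3 by exact: val_inj.
Qed.

Lemma mx2_ext (T : Type) (A B : 'M[T]_2) : A 0 0 = B 0 0 -> A 0 1 = B 0 1 ->
  A 1 0 = B 1 0 -> A 1 1 = B 1 1 -> A = B.
Proof.
by move=> e00 e01 e10 e11; apply/matrixP => i j; move: i j; do 2! elim/ord2P.
Qed.

Lemma tens_ext (T : Type) (A B : 'M[T]_(2 * 2)) :
  (forall i a j b, A (idx i a) (idx j b) = B (idx i a) (idx j b)) -> A = B.
Proof.
move=> AB; apply/matrixP => k l.
by case: (mxtens_indexP k) => i a; case: (mxtens_indexP l) => j b; exact: AB.
Qed.

Lemma mx2E (a b c d : C) :
  (mx2 a b c d 0 0 = a) * (mx2 a b c d 0 1 = b) *
  (mx2 a b c d 1 0 = c) * (mx2 a b c d 1 1 = d).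
Proof. by rewrite !mxE. Qed.

Lemma scale_mx2 (z a b c d : C) :
  z *: mx2 a b c d = mx2 (z * a) (z * b) (z * c) (z * d).
Proof. by apply: mx2_ext; rewrite mxE !mx2E. Qed.

Lemma pauliE : (pauli R 0 = 1%:M) * (pauli R 1 = mx2 0 1 1 0) *
  (pauli R 2 = mx2 0 (- 'i) 'i 0) * (pauli R 3 = mx2 1 0 0 (-1)).
Proof. by []. Qed.

Lemma sigmaE : (sigma R 0 = mx2 0 1 1 0) *
  (sigma R 1 = mx2 0 (- 'i) 'i 0) * (sigma R 2 = mx2 1 0 0 (-1)).
Proof. by []. Qed.

Lemma one2E : ((1%:M : 'M[C]_2) 0 0 = 1) * ((1%:M : 'M[C]_2) 0 1 = 0) *
  ((1%:M : 'M[C]_2) 1 0 = 0) * ((1%:M : 'M[C]_2) 1 1 = 1).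
Proof. by rewrite !mxE. Qed.

Lemma sqr_enorm (s : 'rV[R]_3) :
  enorm s ^+ 2 = s 0 0 ^+ 2 + s 0 1 ^+ 2 + s 0 2 ^+ 2.
Proof.
rewrite sqr_sqrtr ?sum3E //.
by rewrite !addr_ge0 // sqr_ge0.
Qed.

Lemma canonical_stateE (s : 'rV[R]_3) t i a j b :
  canonical_state s t (idx i a) (idx j b) = (4^-1 : R)%:C * (
   (i == j)%:R * ((a == b)%:R + (s 0 0)%:C * sigma R 0 a b
     + (s 0 1)%:C * sigma R 1 a b + (s 0 2)%:C * sigma R 2 a b)
    - t%:C * (sigma R 0 i j * sigma R 0 a b + sigma R 1 i j * sigma R 1 a b
       + sigma R 2 i j * sigma R 2 a b)).
Proof.
rewrite /canonical_state !sum3E /idx.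
do ! rewrite mxE ?tensmxE.
rewrite (_ : (mxtens_index (i, a) == mxtens_index (j, b)) = (i == j) && (a == b)); last first.
  by rewrite (can_eq (@mxtens_indexK 2 2)) xpair_eqE.
case: (i == j); case: (a == b); rewrite /=; ring.
Qed.

End Toolkit.

(** * Rescaled Kraus operators *)

Section KrausForm.
Variable R : realType.
Local Notation C := R[i].
Variables (s : 'rV[R]_3) (t : R).
Hypotheses (adm : admissible s t) (gen : generic s t).

Let a : R := s 0 0.
Let b : R := s 0 1.
Let c : R := s 0 2.
Let n : R := enorm s.
Let r : R := Num.sqrt (n ^+ 2 + 4 * t ^+ 2).
Let m2 : R := a ^+ 2 + b ^+ 2.

(* Rationalised entries of kraus s t: its denominators are absorbed using
   n^2 - c^2 + 4 c t = (r - c + 2 t) (r + c - 2 t) and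
   n^2 + c^2 +- 2 c r = (c +- r)^2 - 4 t^2. *)
Definition kraus_scaled (k : 'I_4) : 'M[C]_2 :=
  let a := s 0 0 in let b := s 0 1 in let c := s 0 2 in
  let n := enorm s in let r := Num.sqrt (n ^+ 2 + 4 * t ^+ 2) in
  let m2 := a ^+ 2 + b ^+ 2 in
  nth 0 [:: mx2 (- a +i* b) (r + 2 * t + c)%:C (- (r + 2 * t - c))%:C (a +i* b);
            mx2 (((n + c) * a) +i* (- ((n + c) * b))) m2%:C
                m2%:C (((n - c) * a) +i* ((n - c) * b));
            mx2 (a -i* b) (r - 2 * t - c)%:C (- (r - 2 * t + c))%:C (- a -i* b);
            mx2 (- ((n - c) * a) +i* ((n - c) * b)) m2%:C
                m2%:C (- ((n + c) * a) -i* ((n + c) * b))] k.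

(* Squared moduli of the scalars between kraus s t k and kraus_scaled k; up to
   normalisation they are the eigenvalues of the Choi state. *)
Definition kraus_weight (k : 'I_4) : R :=
  let n := enorm s in let r := Num.sqrt (n ^+ 2 + 4 * t ^+ 2) in
  let m2 := s 0 0 ^+ 2 + s 0 1 ^+ 2 in
  nth 0 [:: (1 + t + r) / (8 * r * (r + 2 * t));
            (1 + n - t) / (8 * n ^+ 2 * m2);
            (1 + t - r) / (8 * r * (r - 2 * t));
            (1 - n - t) / (8 * n ^+ 2 * m2)] k.

(** Sign conditions that make the radicands positive and the denominators nonzero. The bound
    [r < 1 + t] follows from [n < 1 - t], because (1 + t)^2 - (1 - t)^2 - 4 t^2 = 4 t (1 - t); the
    two last inequalities are the factors of the second denominator in [generic]. *)
Lemma kraus_params :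
  [/\ 0 < t, t < 1, 0 < n, 0 < r - 2 * t & 0 < m2] /\
  [/\ n < 1 - t, r < 1 + t, r - c + 2 * t != 0 & r + c - 2 * t != 0] /\
   n ^+ 2 = a ^+ 2 + b ^+ 2 + c ^+ 2 /\ r ^+ 2 = n ^+ 2 + 4 * t ^+ 2.
Proof.
case: adm => t13 t1 n0 nt; case: gen => g1 g2.
rewrite -/n in n0 nt g2.
have t0 : 0 < t by lra.
have hn : n ^+ 2 = a ^+ 2 + b ^+ 2 + c ^+ 2 by exact: sqr_enorm.
have hr : r ^+ 2 = n ^+ 2 + 4 * t ^+ 2 by rewrite sqr_sqrtr //; nra.
have r0 : 0 <= r by exact: sqrtr_ge0.
have m20 : 0 < m2.
  rewrite lt0r addr_ge0 ?sqr_ge0 // andbT paddr_eq0 ?sqr_ge0 //.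
  by rewrite !sqrf_eq0 negb_and.
have d : (r - c + 2 * t) * (r + c - 2 * t) != 0.
  rewrite (_ : _ * _ = enorm s ^+ 2 - s 0 2 ^+ 2 + 4 * s 0 2 * t) //.
  by rewrite -/n -/c; ring: hr.
move: d; rewrite mulf_eq0 negb_or => /andP[d1 d2].
have n2 : 0 < n ^+ 2 by rewrite exprn_gt0.
have rt : 0 < r - 2 * t by rewrite ltNge; apply/negP => ?; nra.
by do ! split => //; rewrite ltNge; apply/negP => ?; nra.
Qed.

(** A scalar z in front of a Kraus operator enters the channel only through z times its conjugate,
    so its phase may be chosen freely. A purely imaginary z makes the off-diagonal entries real. *)
Lemma kraus_scaledP k : exists2 z : C,
  z * z^*%R = (kraus_weight k)%:C & kraus s t k = z *: kraus_scaled k.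
Proof.
have [[t0 t1 n0 rt m20] [[nt r1 d1 d2] [hn hr]]] := kraus_params.
have cne (x : R) : x != 0 -> x%:C != 0 :> C.
  by rewrite realc_eq0.
have m2E : m2%:C = (a +i* b) * (a -i* b) :> C.
  by apply: complex_ext; rewrite ?ReIm /= /m2; ring.
have ab0 : (a +i* b) != 0 :> C.
  by apply: contraTN m20 => /eqP ab; move: m2E; rewrite ab mul0r => -[->]; rewrite ltxx.
have ab1 : (a -i* b) != 0 :> C.
  by apply: contraTN m20 => /eqP ab; move: m2E; rewrite ab mulr0 => -[->]; rewrite ltxx.
have r0 : 0 < r by lra.
have q2 : Num.sqrt 2 ^+ 2 = 2 :> R by rewrite sqr_sqrtr.
have q0 : Num.sqrt 2 != 0 :> R by rewrite sqrtr_eq0 -ltNge.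
have abE : a%:C + 'i * b%:C = (a +i* b) :> C.
  by apply: complex_ext; rewrite ?ReIm /=; ring.
have abE' : a%:C - 'i * b%:C = (a -i* b) :> C.
  by apply: complex_ext; rewrite ?ReIm /=; ring.
have sqr_i : 'i ^+ 2 = -1 :> C by exact: sqr_i.
have wE (x : R) : Complex 0 x * (Complex 0 x)^*%R = (x ^+ 2)%:C :> C.
  by apply: complex_ext; rewrite ?ReIm /=; ring.
have iE (x : R) : Complex 0 x = 'i * x%:C :> C.
  by apply: complex_ext; rewrite ?ReIm /=; ring.
have cE (x y : R) : Complex x y = x%:C + 'i * y%:C :> C.
  by apply: complex_ext; rewrite ?ReIm /=; ring.
have n'E : n%:C ^+ 2 = a%:C ^+ 2 + b%:C ^+ 2 + c%:C ^+ 2 :> C.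
  by rewrite -!realcX hn !realcE.
have r'E : r%:C ^+ 2 = n%:C ^+ 2 + 4 * t%:C ^+ 2 :> C.
  by rewrite -!realcX hr !realcE.
have dE : (n ^+ 2 - c ^+ 2 + 4 * c * t)%:C =
    (r - c + 2 * t)%:C * (r + c - 2 * t)%:C :> C.
  by rewrite -realcM; congr (_%:C); ring: hr.
have R8 x : (x / (2 * Num.sqrt 2)) ^+ 2 = x ^+ 2 / 8 :> R.
  by field: q2.
(* The last operator divides by [n + c], which is nonzero as a factor of the positive number
   [m2]. *)
have m2c : m2 = (n - c) * (n + c) by rewrite /m2; ring: hn.
have nc : (n + c) != 0 by apply: contraTneq m20 => nc; rewrite m2c nc mulr0 ltxx.
have nc' : (n - c) != 0 by apply: contraTneq m20 => nc'; rewrite m2c nc' mul0r ltxx.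
move: k; apply: ord4P.
(* The factor [2 * t - c + r] of the prefactor is left to the matrix, where it clears a denominator.
   By r^2 = n^2 + 4 t^2 the denominator of the radicand is r (r + 2 t). *)
- exists (Complex 0 (Num.sqrt ((1 + t + r) / (n ^+ 2 + 2 * t * (2 * t + r))) / (2 * Num.sqrt 2))).
    rewrite wE; congr (_%:C); rewrite R8 sqr_sqrtr ?divr_ge0 //; last 2 first.
    - by lra.
    - by nra.
    rewrite /kraus_weight /= -/n -/r.
    rewrite (_ : n ^+ 2 + _ = r * (r + 2 * t)); last by ring: hr.
    field; rewrite !lt0r_neq0 //; lra.
  rewrite /kraus /kraus_scaled /= -/a -/b -/c -/n -/r -/m2.
  set k := Num.sqrt ((1 + t + r) / _).
  rewrite dE iE.
  have -> : c%:C - 2 * t%:C - r%:C = - (r - c + 2 * t)%:C :> C.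
    by rewrite !realcE; ring.
  have -> : - c%:C + 2 * t%:C + r%:C = (r - c + 2 * t)%:C :> C.
    by rewrite !realcE; ring.
  rewrite (_ : (2 * t - c + r) / _ * k = (r - c + 2 * t) * (k / (2 * Num.sqrt 2))); last by field.
  move: (k / (2 * Num.sqrt 2)) (cne _ d1) (cne _ d2) => k'.
  rewrite !cE !realcE => e1 e2.
  by rewrite !scale_mx2; congr (mx2 _ _ _ _); field: sqr_i r'E n'E; rewrite ?e1 ?e2.
(* The division by [m2] compensates for multiplying the matrix through by (s_1 + i s_2)(s_1 - i
   s_2). *)
- exists (Complex 0 (- (Num.sqrt ((n ^+ 2 - c ^+ 2) * (1 + n - t)) / n / m2 / (2 * Num.sqrt 2)))).
    rewrite wE; congr (_%:C); rewrite sqrrN R8 !expr_div_n sqr_sqrtr ?mulr_ge0 //; last 2 first.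
    - by rewrite hn; nra.
    - by lra.
    rewrite /kraus_weight /= -/n -/r -/a -/b -/m2.
    rewrite (_ : n ^+ 2 - c ^+ 2 = m2); last by rewrite hn /m2; ring.
    by field; rewrite !lt0r_neq0.
  rewrite /kraus /kraus_scaled /= -/a -/b -/c -/n -/r -/m2.
  rewrite [(_)^-1 * _]mulrC [X in Complex 0 X](_ : _ = - (Num.sqrt ((n ^+ 2 - c ^+ 2) * (1 + n - t)) / n / (2 * Num.sqrt 2)) / m2); last first.
    by field; rewrite q0 !lt0r_neq0.
  move: (Num.sqrt (_ * (1 + n - t)) / n / (2 * Num.sqrt 2)) (cne _ (lt0r_neq0 m20)) ab0 ab1 => k'.
  rewrite iE !cE !realcE => e0 e1 e2; rewrite !mulrN in e2 *.
  by rewrite !scale_mx2; congr (mx2 _ _ _ _); field: sqr_i n'E; rewrite ?e0 ?e1 ?e2.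
- exists (Complex 0 (Num.sqrt ((1 + t - r) / (n ^+ 2 + 2 * t * (2 * t - r))) / (2 * Num.sqrt 2))).
    have nE : n ^+ 2 + 2 * t * (2 * t - r) = r * (r - 2 * t) by ring: hr.
    rewrite wE; congr (_%:C); rewrite R8 sqr_sqrtr ?divr_ge0 //; last 2 first.
    - by lra.
    - by rewrite nE; nra.
    rewrite /kraus_weight /= -/n -/r nE.
    by field; rewrite !lt0r_neq0.
  rewrite /kraus /kraus_scaled /= -/a -/b -/c -/n -/r -/m2.
  set k := Num.sqrt ((1 + t - r) / _).
  rewrite dE iE.
  have -> : c%:C - 2 * t%:C + r%:C = (r + c - 2 * t)%:C :> C.
    by rewrite !realcE; ring.
  rewrite (_ : (c - 2 * t + r) / _ * k = (r + c - 2 * t) * (k / (2 * Num.sqrt 2))); last by field.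
  move: (k / (2 * Num.sqrt 2)) (cne _ d1) (cne _ d2) => k'.
  rewrite !cE !realcE => e1 e2.
  by rewrite !scale_mx2; congr (mx2 _ _ _ _); field: sqr_i r'E n'E; rewrite ?e1 ?e2.
- exists (Complex 0 (- (Num.sqrt ((n ^+ 2 - c ^+ 2) * (1 - n - t)) / n / m2 / (2 * Num.sqrt 2)))).
    rewrite wE; congr (_%:C); rewrite sqrrN R8 !expr_div_n sqr_sqrtr ?mulr_ge0 //; last 2 first.
    - by rewrite hn; nra.
    - by lra.
    rewrite /kraus_weight /= -/n -/r -/a -/b -/m2.
    rewrite (_ : n ^+ 2 - c ^+ 2 = m2); last by rewrite hn /m2; ring.
    by field; rewrite !lt0r_neq0.
  rewrite /kraus /kraus_scaled /= -/a -/b -/c -/n -/r -/m2.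
  rewrite [(_)^-1 * _]mulrC [X in Complex 0 X](_ : _ = - (Num.sqrt ((n ^+ 2 - c ^+ 2) * (1 - n - t)) / n / (2 * Num.sqrt 2)) / m2); last first.
    by field; rewrite q0 !lt0r_neq0.
  move: (Num.sqrt (_ * (1 - n - t)) / n / (2 * Num.sqrt 2)) (cne _ (lt0r_neq0 m20)) ab0 ab1 (cne _ nc) => k'.
  rewrite iE !cE !realcE => e0 e1 e2 e3; rewrite !mulrN in e2 *.
  by rewrite !scale_mx2; congr (mx2 _ _ _ _); field: sqr_i n'E; rewrite ?e0 ?e1 ?e2 ?e3.
Qed.

End KrausForm.

(** * Choi states *)

Section ChoiState.
Variable R : realType.
Local Notation C := R[i].

Lemma addmxE m n (A B : 'M[C]_(m, n)) i j : (A + B) i j = A i j + B i j.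
Proof. by rewrite mxE. Qed.

Lemma adjE m n (A : 'M[C]_(m, n)) i j : (A^t*) i j = (A j i)^*%R.
Proof. by rewrite !mxE. Qed.

Lemma adjM m n p (A : 'M[C]_(m, n)) (B : 'M[C]_(n, p)) :
  (A *m B)^t* = B^t* *m A^t*.
Proof. by rewrite trmx_mul map_mxM. Qed.

Lemma adjK m n (A : 'M[C]_(m, n)) : A^t*^t* = A.
Proof. by apply/matrixP => i j; rewrite !adjE conjCK. Qed.

Lemma adjmx1 n : (1%:M : 'M[C]_n)^t* = 1%:M.
Proof. by rewrite trmx1 map_mx1. Qed.

Lemma adj_tens m n p q (A : 'M[C]_(m, n)) (B : 'M[C]_(p, q)) :
  (A *t B)^t* = A^t* *t B^t*.
Proof. by rewrite trmx_tens map_mxT. Qed.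

Lemma tens_colE (u v : 'cV[C]_2) i a : (u *t v) (idx i a) 0 = u i 0 * v a 0.
Proof.
by rewrite -(tensmxE u v); congr (fun_of_matrix _ _ _); rewrite [RHS]ord1.
Qed.

Lemma big_tens_index (V : nmodType) m n (F : 'I_(m * n) -> V) :
  \sum_k F k = \sum_i \sum_a F (mxtens_index (i, a)).
Proof.
rewrite pair_big (reindex (@mxtens_index m n)) /=.
  by apply: eq_bigr => -[].
by exists (@mxtens_unindex m n) => ? _; rewrite (mxtens_indexK, mxtens_unindexK).
Qed.

Lemma conj_realc (x : R) : (x%:C)^*%R = x%:C :> C.
Proof. by apply: complex_ext; rewrite ?ReIm //= oppr0. Qed.

Lemma ketE i j : (ket R i) j 0 = (i == j)%:R.
Proof. by rewrite mxE eqxx andbT eq_sym. Qed.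

Lemma sqrtV2 : (Num.sqrt 2)^-1 * (Num.sqrt 2)^-1 = 2^-1 :> R.
Proof. by rewrite -invfM -expr2 sqr_sqrtr. Qed.

Lemma Phi1E i a : Phi1 R (idx i a) 0 = (Num.sqrt 2)^-1%:C * (i == a)%:R.
Proof.
rewrite /Phi1 mxE [X in _ * X]mxE !tens_colE !ketE.
by move: i a; do 2! elim/ord2P; rewrite /= ?(mulr0, mulr1, addr0, add0r).
Qed.

(** The block (i, j) of the Bell projector is half a matrix unit, so the Choi state tabulates the
    values of [L] on matrix units. *)
Lemma choiE (L : 'M[C]_2 -> 'M[C]_2) i a j b : scalable L ->
  choi L (idx i a) (idx j b) = 2^-1 * L (delta_mx i j) a b.
Proof.
move=> LZ; rewrite /choi /id_tens summxE (bigD1 i) //= [X in _ + X]big1 ?addr0; last first.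
  move=> i' i'i; rewrite summxE big1 // => j' _.
  by rewrite tensmxE mxE eq_sym (negPf i'i) mul0r.
rewrite summxE (bigD1 j) //= big1 ?addr0; last first.
  by move=> j' j'j; rewrite tensmxE mxE [j == j']eq_sym (negPf j'j) andbF mul0r.
rewrite tensmxE mxE !eqxx mul1r.
rewrite (_ : \matrix_(_, _) _ = 2^-1 *: delta_mx i j) ?LZ 1?mxE //.
apply/matrixP => k l; rewrite !mxE big_ord1 adjE !Phi1E.
rewrite -(realc_nat R (j == l)) -realcM conj_realc realcM realc_nat.
rewrite mulrACA -realcM sqrtV2 realcV realc_nat -natrM mulnb [k == i]eq_sym.
by rewrite [l == j]eq_sym.
Qed.

Lemma linear_mx2_eq (L M : 'M[C]_2 -> 'M[C]_2) : linear L -> linear M ->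
  (forall i j, L (delta_mx i j) = M (delta_mx i j)) -> L =1 M.
Proof.
move=> linL linM LM X.
pose L' : {linear _ -> _} := HB.pack L (GRing.isLinear.Build _ _ _ _ L linL).
pose M' : {linear _ -> _} := HB.pack M (GRing.isLinear.Build _ _ _ _ M linM).
have -> : L = L' by []. have -> : M = M' by [].
rewrite (matrix_sum_delta X) !linear_sum; apply: eq_bigr => i _.
rewrite !linear_sum; apply: eq_bigr => j _.
by rewrite !linearZ /= LM.
Qed.

Lemma linear_scalable (L : 'M[C]_2 -> 'M[C]_2) : linear L -> scalable L.
Proof.
move=> linL; pose L' : {linear _ -> _} := HB.pack L (GRing.isLinear.Build _ _ _ _ L linL).
by have -> : L = L' by []; move=> ? ?; rewrite linearZ.
Qed.

Lemma choi_inj (L M : 'M[C]_2 -> 'M[C]_2) : linear L -> linear M ->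
  choi L = choi M -> L =1 M.
Proof.
move=> linL linM LM; apply: linear_mx2_eq => // i j; apply/matrixP => a b.
have /matrixP/(_ (idx i a) (idx j b)) := LM.
rewrite !choiE; try exact: linear_scalable.
by move=> /(mulfI _); apply; rewrite invr_eq0 pnatr_eq0.
Qed.

Lemma kraus_map_linear (K : 'I_4 -> 'M[C]_2) : linear (kraus_map K).
Proof.
move=> c X Y; rewrite /kraus_map scaler_sumr -big_split; apply: eq_bigr => k _.
by rewrite /= mulmxDr mulmxDl -scalemxAr -scalemxAl.
Qed.

Lemma choi_kraus_map (K : 'I_4 -> 'M[C]_2) i a j b :
  choi (kraus_map K) (idx i a) (idx j b) =
  2^-1 * \sum_k K k a i * (K k b j)^*%R.
Proof.
rewrite choiE; last exact/linear_scalable/kraus_map_linear.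
congr (_ * _); rewrite summxE; apply: eq_bigr => k _.
rewrite mxE (bigD1 j) //= big1 ?addr0 => [|j' j'j]; rewrite mxE.
  rewrite (bigD1 i) //= big1 ?addr0 => [|i' i'i]; last first.
    by rewrite !mxE (negPf i'i) mulr0.
  by rewrite !mxE !eqxx mulr1.
by rewrite big1 ?mul0r // => i' _; rewrite !mxE (negPf j'j) andbF mulr0.
Qed.

Lemma rotate_linear U V (L : 'M[C]_2 -> 'M[C]_2) : linear L -> linear (rotate U V L).
Proof.
move=> linL c X Y; rewrite /rotate.
by rewrite mulmxDr mulmxDl -scalemxAr -scalemxAl linL mulmxDr mulmxDl -scalemxAr -scalemxAl.
Qed.

Lemma choi_sum (L : 'M[C]_2 -> 'M[C]_2) : scalable L ->
  choi L = 2^-1 *: \sum_i \sum_j delta_mx i j *t L (delta_mx i j).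
Proof.
move=> LZ; apply: tens_ext => i a j b; rewrite choiE // !sum2E.
rewrite [RHS]mxE !addmxE !tensmxE !mxE.
by move: i j; do 2! elim/ord2P; rewrite /= ?(mul0r, mul1r, addr0, add0r).
Qed.

Lemma choi_rotate U V (L : 'M[C]_2 -> 'M[C]_2) : linear L ->
  choi (rotate U V L) = local_unitary U V (choi L).
Proof.
move=> linL; rewrite choi_sum; last exact/linear_scalable/rotate_linear.
rewrite choi_sum; last exact/linear_scalable.
pose L' : {linear _ -> _} := HB.pack L (GRing.isLinear.Build _ _ _ _ L linL).
rewrite /local_unitary -scalemxAr -scalemxAl; congr (_ *: _).
have -> : L = L' by [].
(* Both sides are expanded over matrix units. The transpose in [rotate] yields the coefficient
   [U i k * (U j l)^*], which is the (i, j) entry of [delta_mx k l] conjugated by [U]. *)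
transitivity (\sum_k \sum_l (U *m delta_mx k l *m U^t*) *t (V *m L' (delta_mx k l) *m V^t*)).
  have E i j : rotate U V L' (delta_mx i j) = \sum_k \sum_l (U i k * (U j l)^*%R) *: (V *m L' (delta_mx k l) *m V^t*).
    rewrite /rotate [X in L' X]matrix_sum_delta linear_sum mulmx_sumr mulmx_suml.
    apply: eq_bigr => k _; rewrite linear_sum mulmx_sumr mulmx_suml; apply: eq_bigr => l _.
    rewrite linearZ /= -scalemxAr -scalemxAl; congr (_ *: _).
    rewrite mxE (bigD1 j) //= big1 ?addr0 => [|j' j'j]; rewrite mxE.
      rewrite (bigD1 i) //= big1 ?addr0 => [|i' i'i]; last first.
        by rewrite !mxE (negPf i'i) mulr0.
      by rewrite !mxE !eqxx mulr1.
    by rewrite big1 ?mul0r // => i' _; rewrite !mxE (negPf j'j) andbF mulr0.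
  apply: tens_ext => i a j b; rewrite !summxE.
  rewrite (bigD1 i) //= [X in _ + X]big1 ?addr0; last first.
    move=> i' i'i; rewrite summxE big1 // => j' _.
    by rewrite tensmxE mxE eq_sym (negPf i'i) mul0r.
  rewrite summxE (bigD1 j) //= big1 ?addr0; last first.
    by move=> j' j'j; rewrite tensmxE mxE [j == j']eq_sym (negPf j'j) andbF mul0r.
  rewrite tensmxE mxE !eqxx mul1r E summxE; apply: eq_bigr => k _.
  rewrite !summxE; apply: eq_bigr => l _; rewrite tensmxE [LHS]mxE; congr (_ * _).
  rewrite mxE (bigD1 l) //= big1 ?addr0 => [|l' l'l]; rewrite mxE.
    rewrite (bigD1 k) //= big1 ?addr0 => [|k' k'k]; last first.
      by rewrite !mxE (negPf k'k) mulr0.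
    by rewrite !mxE !eqxx mulr1.
  by rewrite big1 ?mul0r // => k' _; rewrite !mxE (negPf l'l) andbF mulr0.
rewrite mulmx_sumr mulmx_suml; apply: eq_bigr => k _.
rewrite mulmx_sumr mulmx_suml; apply: eq_bigr => l _.
by rewrite adj_tens !tensmx_mul.
Qed.
End ChoiState.

(** * Orthogonality and Choi state of the explicit Kraus operators *)

Section KrausFamily.
Variable R : realType.
Local Notation C := R[i].

Lemma mxtrace_adj_mul (A B : 'M[C]_2) : \tr (A^t* *m B) =
  (A 0 0)^*%R * B 0 0 + (A 0 1)^*%R * B 0 1 + (A 1 0)^*%R * B 1 0 + (A 1 1)^*%R * B 1 1.
Proof.
by rewrite /mxtrace sum2E !mxE !sum2E !mxE; ring.
Qed.

Lemma kraus_orthogonal (s : 'rV[R]_3) t : admissible s t -> generic s t ->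
  forall k l : 'I_4, k != l -> \tr ((kraus s t k)^t* *m kraus s t l) = 0.
Proof.
move=> adm gen k l kl.
have [[t0 t1 n0 rt m20] [[nt r1 d1 d2] [hn hr]]] := kraus_params adm gen.
have [z _ ->] := kraus_scaledP adm gen k; have [y _ ->] := kraus_scaledP adm gen l.
suff h : \tr ((kraus_scaled s t k)^t* *m kraus_scaled s t l) = 0.
  have -> : (z *: kraus_scaled s t k)^t* = z^*%R *: (kraus_scaled s t k)^t*.
    by apply/matrixP => i j; rewrite !mxE rmorphM.
  by rewrite -scalemxAl -scalemxAr scalerA mxtraceZ h mulr0.
rewrite mxtrace_adj_mul.
move: kl; move: k l; rewrite /kraus_scaled.
move: hn hr; set n := enorm s; set r : R := Num.sqrt _ => hn hr.
by do 2! elim/ord4P => //; move=> _; rewrite /= !mx2E; apply: complex_ext; rewrite ?ReIm /=; ring: hn hr.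
Qed.

(** The Kraus operators being orthogonal, this is the spectral decomposition of
    [canonical_state s t]. It is checked entry by entry as sixteen rational identities modulo the
    quadratic relations between the parameters. *)
Lemma choi_kraus (s : 'rV[R]_3) t : admissible s t -> generic s t ->
  choi (kraus_map (kraus s t)) = canonical_state s t.
Proof.
move=> adm gen; apply: tens_ext => i a j b.
rewrite choi_kraus_map canonical_stateE.
have [[t0 t1 n0 rt m20] [[nt r1 d1 d2] [hn hr]]] := kraus_params adm gen.
have -> : \sum_k kraus s t k a i * (kraus s t k b j)^*%R =
    \sum_k (kraus_weight s t k)%:C * (kraus_scaled s t k a i * (kraus_scaled s t k b j)^*%R).
  apply: eq_bigr => k _; have [z <- ->] := kraus_scaledP adm gen k.
  by rewrite !mxE rmorphM mulrACA.
rewrite sum4E /kraus_weight /kraus_scaled /=.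
move: n0 rt m20 hn hr; set n := enorm s; set r : R := Num.sqrt _ => n0 rt m20 hn hr.
have w2 : r - 2 * t != 0 by rewrite lt0r_neq0.
have w0 : r + 2 * t != 0 by rewrite lt0r_neq0 //; lra.
have wr : r != 0 by rewrite lt0r_neq0 //; lra.
have wn : n != 0 by rewrite lt0r_neq0.
have wm := lt0r_neq0 m20.
(* Rationalising removes [r - 2 * t] and [r + 2 * t] from the denominators of the weights; only [r],
   [n] and [m] remain there. *)
have nE : n ^+ 2 = (r - 2 * t) * (r + 2 * t) by ring: hr.
have -> : (1 + t + r) / (8 * r * (r + 2 * t)) =
    (1 + t + r) * (r - 2 * t) / (8 * r * n ^+ 2).
  by rewrite nE; field; rewrite wr w0 w2.
have -> : (1 + t - r) / (8 * r * (r - 2 * t)) =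
    (1 + t - r) * (r + 2 * t) / (8 * r * n ^+ 2).
  by rewrite nE; field; rewrite wr w0 w2.
(* The sum s_1^2 + s_2^2 becomes an invertible atom [m]; the squares of s_1 and s_3 are then
   rewritten in terms of [m], which gives [field] an oriented system of relations. *)
have [m mE] : exists m, s 0 0 ^+ 2 + s 0 1 ^+ 2 = m by exists (s 0 0 ^+ 2 + s 0 1 ^+ 2).
have hm : s 0 0 ^+ 2 = m - s 0 1 ^+ 2 by rewrite -mE addrK.
have hc : s 0 2 ^+ 2 = n ^+ 2 - m by rewrite hn -mE; ring.
rewrite !mE in wm *; clear -hm hc hr wr wn wm.
move: hm hc; move: (s 0 0) (s 0 1) (s 0 2) => x y z hm hc.
clearbody r n.
have cE (u v : R) : Complex u v = u%:C + 'i * v%:C :> C.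
  by apply: complex_ext; rewrite ?ReIm /=; ring.
have jE (u v : R) : (Complex u v)^*%R = u%:C - 'i * v%:C :> C.
  by apply: complex_ext; rewrite ?ReIm /=; ring.
have sqr_i : 'i ^+ 2 = -1 :> C by exact: sqr_i.
have hm' : x%:C ^+ 2 = m%:C - y%:C ^+ 2 :> C by rewrite -realcX hm !realcE.
have hc' : z%:C ^+ 2 = n%:C ^+ 2 - m%:C :> C by rewrite -realcX hc !realcE.
have hr' : r%:C ^+ 2 = n%:C ^+ 2 + 4 * t%:C ^+ 2 :> C by rewrite -realcX hr !realcE.
have wr' : r%:C != 0 :> C by rewrite realc_eq0.
have wn' : n%:C != 0 :> C by rewrite realc_eq0.
have wm' : m%:C != 0 :> C by rewrite realc_eq0.
move: i a j b; do 4! elim/ord2P.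
all: rewrite !sigmaE !mx2E /= ?mulr1n ?mulr0n ?conj_realc ?jE ?cE !realcE.
all: by field: sqr_i hm' hc' hr'; rewrite ?wr' ?wm' ?wn'.
Qed.
End KrausFamily.

(** * Positivity *)

Section Positivity.
Variable R : realType.
Local Notation C := R[i].

Lemma psd_congr m n (B : 'M[C]_(m, n)) (X : 'M[C]_n) : psd X -> psd (B *m X *m B^t*).
Proof.
by move=> X0 v; have := X0 (B^t* *m v); rewrite adjM adjK !mulmxA.
Qed.

Lemma psd_sum (I : finType) n (F : I -> 'M[C]_n) :
  (forall i, psd (F i)) -> psd (\sum_i F i).
Proof.
move=> F0 v; rewrite mulmx_sumr mulmx_suml summxE.
by apply: sumr_ge0 => i _; exact: F0.
Qed.

Lemma psd_rank1 n (v : 'cV[C]_n) : psd (v *m v^t*).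
Proof.
have psd1 : psd (1%:M : 'M[C]_1).
  move=> w; rewrite mulmx1 mxE big_ord1 adjE mulrC.
  exact: mul_conjC_ge0.
by have := psd_congr v psd1; rewrite mulmx1.
Qed.

Lemma id_tensE n (L : 'M[C]_2 -> 'M[C]_2) (X : 'M[C]_(n * 2)) i a j b :
  id_tens L X (mxtens_index (i, a)) (mxtens_index (j, b)) =
  L (\matrix_(a, b) X (mxtens_index (i, a)) (mxtens_index (j, b))) a b.
Proof.
rewrite /id_tens summxE (bigD1 i) //= [X in _ + X]big1 ?addr0; last first.
  move=> i' i'i; rewrite summxE big1 // => j' _.
  by rewrite tensmxE mxE eq_sym (negPf i'i) mul0r.
rewrite summxE (bigD1 j) //= [X in _ + X]big1 ?addr0; last first.
  by move=> j' j'j; rewrite tensmxE mxE [j == j']eq_sym (negPf j'j) andbF mul0r.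
by rewrite tensmxE mxE !eqxx mul1r.
Qed.

Lemma id_tens_kraus n (K : 'I_4 -> 'M[C]_2) (X : 'M[C]_(n * 2)) :
  id_tens (kraus_map K) X =
  \sum_k ((1%:M : 'M[C]_n) *t K k) *m X *m ((1%:M : 'M[C]_n) *t K k)^t*.
Proof.
apply/matrixP => x y; case: (mxtens_indexP x) => i a; case: (mxtens_indexP y) => j b.
rewrite id_tensE !summxE; apply: eq_bigr => k _.
have mul1tens (A : 'M[C]_(n * 2)) i' a' y' :
    (((1%:M : 'M[C]_n) *t K k) *m A) (mxtens_index (i', a')) y' =
    \sum_c K k a' c * A (mxtens_index (i', c)) y'.
  rewrite mxE big_tens_index (bigD1 i') //= [X in _ + X]big1 ?addr0 => [|l li].
    by apply: eq_bigr => c _; rewrite tensmxE mxE eqxx mul1r.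
  by rewrite big1 // => c _; rewrite tensmxE mxE eq_sym (negPf li) !mul0r.
rewrite mxE [RHS]mxE big_tens_index (bigD1 j) //= [X in _ + X]big1 ?addr0 => [|l li].
  apply: eq_bigr => c _; rewrite mul1tens adj_tens adjmx1 tensmxE [X in X * _]mxE.
  rewrite [(1%:M) _ _]mxE eqxx mul1r; congr (_ * _).
  by apply: eq_bigr => d _; rewrite mxE.
rewrite big1 // => c _.
by rewrite adj_tens adjmx1 tensmxE [(1%:M) _ _]mxE (negPf li) mul0r mulr0.
Qed.

Lemma kraus_map_cp (K : 'I_4 -> 'M[C]_2) : completely_positive (kraus_map K).
Proof.
move=> n X X0; rewrite id_tens_kraus; apply: psd_sum => k.
exact: psd_congr.
Qed.

Lemma kraus_map_tp (K : 'I_4 -> 'M[C]_2) :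
  \sum_k (K k)^t* *m K k = 1%:M -> trace_preserving (kraus_map K).
Proof.
move=> K1 X; rewrite -[in RHS](mul1mx X) -K1 mulmx_suml /kraus_map !linear_sum.
by apply: eq_bigr => k _; rewrite /= mxtrace_mulC !mulmxA.
Qed.

Lemma psd_choi (L : 'M[C]_2 -> 'M[C]_2) : completely_positive L -> psd (choi L).
Proof. by move=> Lcp; apply/Lcp/psd_rank1. Qed.

(** The order on [C] compares only numbers with equal imaginary parts, so the quadratic form of [A]
    is real. Polarisation on e_i + e_j and e_i + i e_j then determines conjugate entries. *)
Lemma psd_herm n (A : 'M[C]_n) : psd A -> A^t* = A.
Proof.
move=> A0.
have q (i j : 'I_n) (z : C) : 0 <= A i i + z * A i j + z^*%R * A j i + z^*%R * z * A j j.
  have := A0 (delta_mx i 0 + z *: delta_mx j 0).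
  have -> : (delta_mx i 0 + z *: delta_mx j 0 : 'cV[C]_n)^t* = delta_mx 0 i + z^*%R *: delta_mx 0 j.
    by rewrite linearD linearZ /= map_mxD map_mxZ !trmx_delta !map_delta_mx.
  rewrite mulmxDr !mulmxDl -!scalemxAr -!scalemxAl -!rowE -!colE.
  rewrite !(mxE, ord1) => h; apply: (le_trans h); rewrite le_eqVlt; apply/orP; left; apply/eqP; ring.
apply/matrixP => i j; rewrite adjE.
have := q i j 1; have := q i j 'i; have := q i i 0; have := q j j 0.
rewrite !lecE !ReIm /= => /andP[/eqP h1 _] /andP[/eqP h2 _] /andP[/eqP h3 _] /andP[/eqP h4 _].
apply: complex_ext; rewrite ?ReIm; lra.
Qed.

End Positivity.

(** * Teleportation fidelity *)

Section Fidelity.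
Variable R : realType.
Local Notation C := R[i].

Lemma oppmxE m n (A : 'M[C]_(m, n)) i j : (- A) i j = - A i j.
Proof. by rewrite mxE. Qed.

Lemma scalemxE m n c (A : 'M[C]_(m, n)) i j : (c *: A) i j = c * A i j.
Proof. by rewrite mxE. Qed.

Lemma bob_opE (psi : 'cV[C]_2) k b c d :
  bob_op psi k b (idx c d) =
  (\sum_i (bell R k (idx i c) 0)^*%R * psi i 0) * (b == d)%:R.
Proof.
have rowE (w : 'cV[C]_(2 * 2)) (x : 'I_(2 * 2)) (b1 b' : 'I_2) :
    (w^t* *t (1%:M : 'M[C]_2)) b1 (mxtens_index (x, b')) = (w x 0)^*%R * (b1 == b')%:R.
  (* ['I_(1 * 2)] is convertible to ['I_2], and the two bracketings of the threefold tensor product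
     have convertible index types; only the index encodings have to be identified. *)
  have e : b1 = mxtens_index (0 : 'I_1, b1) by apply: val_inj; rewrite /= mul0n.
  have := tensmxE (w^t*) (1%:M : 'M[C]_2) 0 b1 x b'.
  by rewrite -e => ->; rewrite adjE [(1%:M) _ _]mxE.
have colE (i a b' : 'I_2) :
    (psi *t (1%:M : 'M[C]_(2 * 2))) (mxtens_index (idx i a, b')) (idx c d) =
    psi i 0 * ((a == c) && (b' == d))%:R.
  have e1 : mxtens_index (idx i a, b') = mxtens_index (i, idx a b') :> 'I_(2 * (2 * 2)).
    by apply: val_inj => /=; rewrite mulnDl -mulnA addnA.
  have e2 : idx c d = mxtens_index (0 : 'I_1, idx c d).
    by apply: val_inj => /=; rewrite mul0n.
  have := tensmxE psi (1%:M : 'M[C]_(2 * 2)) i (idx a b') 0 (idx c d).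
  rewrite -e1 -e2 => ->; rewrite [(1%:M) _ _]mxE.
  by rewrite (can_eq (@mxtens_indexK 2 2)) xpair_eqE.
rewrite /bob_op mxE (@big_tens_index _ (2 * 2) 2) big_tens_index mulr_suml.
apply: eq_bigr => i _; rewrite (bigD1 c) //= [X in _ + X]big1 ?addr0 => [|a ac].
  rewrite (bigD1 d) //= [X in _ + X]big1 ?addr0 => [|b' bd].
    by rewrite rowE colE !eqxx mulr1 mulrAC.
  by rewrite rowE colE (negPf bd) andbF !mulr0.
by rewrite big1 // => b' _; rewrite rowE colE (negPf ac) !mulr0.
Qed.

(** Bell outcome, correction and final overlap with the input, pulled back to the resource: outcome
    [k] contributes to the fidelity the quadratic form of [rho] at this vector. *)
Definition teleport_vec (psi : 'cV[C]_2) (k : 'I_4) : 'cV[C]_(2 * 2) :=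
  (bob_op psi k)^t* *m ((pauli R k)^t* *m psi).

Lemma fidelity_trace (rho : 'M[C]_(2 * 2)) psi :
  fidelity rho psi =
  Re (\tr (rho *m \sum_k teleport_vec psi k *m (teleport_vec psi k)^t*)).
Proof.
rewrite /fidelity /teleport; congr (Re _).
rewrite [in LHS]mulmx_sumr [in LHS]mulmx_suml summxE mulmx_sumr linear_sum; apply: eq_bigr => k _.
rewrite /teleport_vec /= -trace_mx11 !mulmxA.
by rewrite [RHS]mxtrace_mulC !adjM !adjK !mulmxA.
Qed.

Lemma teleport_vecE psi k c d : teleport_vec psi k (idx c d) 0 =
  (\sum_i bell R k (idx i c) 0 * (psi i 0)^*%R) * (\sum_b (pauli R k b d)^*%R * psi b 0).
Proof.
rewrite /teleport_vec mxE (bigD1 d) //= [X in _ + X]big1 ?addr0 => [|b bd].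
  rewrite adjE bob_opE eqxx mulr1 rmorph_sum mxE; congr (_ * _).
    by apply: eq_bigr => i _; rewrite rmorphM /= conjCK.
  by apply: eq_bigr => b _; rewrite adjE.
by rewrite adjE bob_opE (negPf bd) mulr0 conjC0 mul0r.
Qed.

Lemma PsiMinusE i a : PsiMinus R (idx i a) 0 =
  (Num.sqrt 2)^-1%:C * ((i == 0)%:R * (a == 1)%:R - (i == 1)%:R * (a == 0)%:R).
Proof.
rewrite /PsiMinus mxE [X in _ * X]addmxE [X in _ + X]mxE !tens_colE !ketE.
by rewrite ![_ == i]eq_sym ![_ == a]eq_sym.
Qed.

Lemma bellE k i c : bell R k (idx i c) 0 = \sum_j pauli R k i j * PsiMinus R (idx j c) 0.
Proof.
rewrite /bell mxE big_tens_index; apply: eq_bigr => j _.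
rewrite (bigD1 c) //= [X in _ + X]big1 ?addr0 => [|a ac].
  by rewrite tensmxE [(1%:M) _ _]mxE eqxx mulr1.
by rewrite tensmxE [(1%:M) _ _]mxE eq_sym (negPf ac) mulr0 mul0r.
Qed.

Definition teleport_coef (psi : 'cV[C]_2) (k : 'I_4) : 'M[C]_2 :=
  let x := psi 0 0 in let y := psi 1 0 in
  let x' := x^*%R in let y' := y^*%R in
  nth 0 [:: mx2 (- (y' * x)) (- (y' * y)) (x' * x) (x' * y);
            mx2 (- (x' * y)) (- (x' * x)) (y' * y) (y' * x);
            mx2 (x' * y) (- (x' * x)) (y' * y) (- (y' * x));
            mx2 (y' * x) (- (y' * y)) (x' * x) (- (x' * y))] k.

Lemma teleport_vec_coef psi k c d : teleport_vec psi k (idx c d) 0 =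
  (Num.sqrt 2)^-1%:C * teleport_coef psi k c d.
Proof.
have sqr_i : 'i ^+ 2 = -1 :> C by exact: sqr_i.
have conj_i : 'i^*%R = - 'i :> C by apply: complex_ext; rewrite ?ReIm /= ?oppr0.
have iE : Complex 0 1 = 'i%R :> C by [].
have c0 : (0 : C)^*%R = 0 by exact: conjC0.
have c1 : (1 : C)^*%R = 1 by exact: conjC1.
rewrite teleport_vecE !sum2E !bellE !sum2E !PsiMinusE /teleport_coef.
move: (psi 0 0) (psi 1 0) ((Num.sqrt 2)^-1%:C) => x y h.
move: (x^*%R) (y^*%R) => x' y'.
move: k c d; elim/ord4P; do 2! elim/ord2P.
all: rewrite !pauliE ?one2E ?mx2E /= ?(mulr1n, mulr0n) ?rmorphN /= ?iE ?conj_i ?c0 ?c1.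
all: by ring: sqr_i.
Qed.

(** The expectation of [sigma i] in the unnormalised vector [psi], written as a polynomial in the
    amplitudes and their conjugates. *)
Definition bloch_coord (psi : 'cV[C]_2) (i : 'I_3) : C :=
  let a := psi 0 0 in let b := psi 1 0 in
  nth 0 [:: a^*%R * b + a * b^*%R; 'i * (a * b^*%R - a^*%R * b);
    a * a^*%R - b * b^*%R] i.

(* The four Bell outcomes together leave only the sigma_i (x) sigma_i. *)
Lemma teleport_projector psi :
  \sum_k teleport_vec psi k *m (teleport_vec psi k)^t* =
  2^-1 *: ((psi 0 0 * (psi 0 0)^*%R + psi 1 0 * (psi 1 0)^*%R) ^+ 2 *: 1%:M
    - \sum_i bloch_coord psi i ^+ 2 *: (sigma R i *t sigma R i)).
Proof.
have sqr_i : 'i ^+ 2 = -1 :> C by exact: sqr_i.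
have iE : Complex 0 1 = 'i%R :> C by [].
apply: tens_ext => i a j b; rewrite summxE.
have -> : \sum_k (teleport_vec psi k *m (teleport_vec psi k)^t*) (idx i a) (idx j b) =
    2^-1 * \sum_k (teleport_coef psi k i a * (teleport_coef psi k j b)^*%R).
  rewrite mulr_sumr; apply: eq_bigr => k _.
  rewrite mxE big_ord1 adjE !teleport_vec_coef rmorphM /= conj_realc mulrACA.
  by rewrite -realcM sqrtV2 realcV realc_nat.
rewrite sum4E sum3E scalemxE addmxE oppmxE !addmxE !scalemxE !tensmxE; congr (_ * _).
have -> : (1%:M : 'M[C]_(2 * 2)) (idx i a) (idx j b) = ((i == j) && (a == b))%:R.
  by rewrite mxE (can_eq (@mxtens_indexK 2 2)) xpair_eqE.
rewrite /bloch_coord /teleport_coef; move: (psi 0 0) (psi 1 0) => x y.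
move: i a j b; do 4! elim/ord2P.
all: rewrite !sigmaE !mx2E /= ?(mulr1n, mulr0n) ?(rmorphN, rmorphM) /= ?conjCK ?iE.
(* The identity holds with the conjugates taken as independent variables. *)
all: move: (x^*%R) (y^*%R) => x' y'; by ring: sqr_i.
Qed.
End Fidelity.

(** * Averages over the Bloch sphere *)

Section Averages.
Variable R : realType.
Local Notation C := R[i].

(** The vector [bloch theta phi] has norm one, and its Bloch coordinates are the spherical
    coordinates of the point; the double-angle formulas pass from theta / 2 to theta. *)
Lemma fidelity_bloch (rho : 'M[C]_(2 * 2)) theta phi :
  fidelity rho (bloch theta phi) =
  2^-1 * (Re (\tr rho) - (sin theta * cos phi) ^+ 2 * correlation rho 0 0
    - (sin theta * sin phi) ^+ 2 * correlation rho 1 1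
    - cos theta ^+ 2 * correlation rho 2 2).
Proof.
rewrite fidelity_trace teleport_projector.
set al := bloch theta phi 0 0; set be := bloch theta phi 1 0.
have alE : al = (cos (theta / 2))%:C.
  by rewrite /al /bloch !mxE /= mulr1 mulr0 addr0.
have beE : be = (cos phi +i* sin phi) * (sin (theta / 2))%:C.
  by rewrite /be /bloch !mxE /= mulr1 mulr0 add0r.
have c2 := sin2cos2 (theta / 2); have p2 := sin2cos2 phi.
have tE : theta = theta / 2 *+ 2 by rewrite -mulr_natr divfK.
have sE : sin theta = cos (theta / 2) * sin (theta / 2) *+ 2.
  by rewrite [in LHS]tE sin_mulr2n.
have cE : cos theta = cos (theta / 2) ^+ 2 - sin (theta / 2) ^+ 2.
  by rewrite [in LHS]tE cos_mulr2n sin2cos2; ring.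
have al'E : al^*%R = (cos (theta / 2))%:C by rewrite alE conj_realc.
have cplxE (x y : R) : Complex x y = x%:C + 'i * y%:C :> C.
  by apply: complex_ext; rewrite ?ReIm /=; ring.
have be'E : be^*%R = ((cos phi)%:C - 'i * (sin phi)%:C) * (sin (theta / 2))%:C.
  rewrite beE rmorphM /= conj_realc; congr (_ * _).
  by apply: complex_ext; rewrite ?ReIm /=; ring.
rewrite cplxE in beE.
have sqr_i : 'i ^+ 2 = -1 :> C by exact: sqr_i.
have c2' : (sin (theta / 2))%:C ^+ 2 = 1 - (cos (theta / 2))%:C ^+ 2 :> C by rewrite -realcX c2 !realcE.
have p2' : (sin phi)%:C ^+ 2 = 1 - (cos phi)%:C ^+ 2 :> C by rewrite -realcX p2 !realcE.
have -> : al * al^*%R + be * be^*%R = 1.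
  by rewrite al'E be'E alE beE; ring: sqr_i c2' p2'.
have b0 : bloch_coord (bloch theta phi) 0 = (sin theta * cos phi)%:C.
  by rewrite /bloch_coord /= -/al -/be al'E be'E alE beE sE; ring: sqr_i.
have b1 : bloch_coord (bloch theta phi) 1 = (sin theta * sin phi)%:C.
  by rewrite /bloch_coord /= -/al -/be al'E be'E alE beE sE; ring: sqr_i.
have b2 : bloch_coord (bloch theta phi) 2 = (cos theta)%:C.
  by rewrite /bloch_coord /= -/al -/be al'E be'E alE beE cE; ring: sqr_i p2'.
have corrE i : correlation rho i i = Re (\tr (rho *m (sigma R i *t sigma R i))).
  by rewrite mxE.
rewrite sum3E b0 b1 b2 expr1n scale1r -!realcX !corrE.
move: (sigma R 0 *t sigma R 0) (sigma R 1 *t sigma R 1) (sigma R 2 *t sigma R 2) => S0 S1 S2.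
rewrite -scalemxAr mxtraceZ mulmxBr !mulmxDr -!scalemxAr mulmx1.
rewrite linearB !linearD /= !mxtraceZ.
move: (\tr rho) (\tr (rho *m S0)) (\tr (rho *m S1)) (\tr (rho *m S2)) => z z0 z1 z2.
have -> : 2^-1 = (2^-1 : R)%:C :> C by rewrite realcV realc_nat.
have ReZ (x : R) (u : C) : Re (x%:C * u) = x * Re u by rewrite cReM /= mul0r subr0.
rewrite ReZ !(cReD, cReN) !ReZ; move: (Re z) (Re z0) (Re z1) (Re z2) => *; ring.
Qed.

Lemma Rintegral_derive (F f : R -> R) (a b : R) : a < b ->
  (forall x, is_derive x (1 : R) F (f x)) -> (forall x, derivable f x (1 : R)) ->
  \int[lebesgue_measure]_(x in `[a, b]) f x = F b - F a.
Proof.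
move=> ab dF df.
have contF x : {for x, continuous F}.
  by apply/differentiable_continuous/derivable1_diffP; case: (dF x).
rewrite /Rintegral (@continuous_FTC2 R f F) //=.
- apply: continuous_subspaceT => x.
  by apply/differentiable_continuous/derivable1_diffP/df.
- split => [x _||]; first by case: (dF x).
  + by apply: cvg_at_right_filter; exact: contF.
  + by apply: cvg_at_left_filter; exact: contF.
- by move=> x _; rewrite derive1E; case: (dF x).
Qed.

Lemma Rintegral_cos_sin (p0 p2 p4 : R) :
  \int[lebesgue_measure]_(x in `[0, pi])
    ((p0 + p2 * cos x ^+ 2 + p4 * cos x ^+ 4) * sin x) =
  2 * p0 + 2 / 3 * p2 + 2 / 5 * p4.
Proof.
(* Antiderivative from the substitution u = cos x. *)
pose F (x : R) := - (p0 * cos x + p2 / 3 * cos x ^+ 3 + p4 / 5 * cos x ^+ 5).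
have dF (x : R) : is_derive x 1 F ((p0 + p2 * cos x ^+ 2 + p4 * cos x ^+ 4) * sin x).
  by rewrite /F; apply: is_derive_eq; rewrite /GRing.scale /=; field.
rewrite (Rintegral_derive (pi_gt0 R) dF).
- by rewrite /F cospi cos0; field.
- by move=> x; apply: ex_derive.
Qed.

Lemma Rintegral_cos4 (q0 q1 q2 : R) :
  \int[lebesgue_measure]_(x in `[0, 2 * pi])
    (q0 + q1 * cos x ^+ 2 + q2 * cos x ^+ 4) =
  pi * (2 * q0 + q1 + 3 / 4 * q2).
Proof.
(* Antiderivatives of cos^2 and cos^4 by reduction; the terms with a factor sin x vanish at both
   ends. *)
pose F (x : R) := q0 * x + q1 * (x / 2 + sin x * cos x / 2) +
  q2 * (3 / 8 * x + 3 / 8 * (sin x * cos x) + sin x * cos x ^+ 3 / 4).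
have dF (x : R) : is_derive x 1 F (q0 + q1 * cos x ^+ 2 + q2 * cos x ^+ 4).
  have s2 := sin2cos2 x.
  by rewrite /F; apply: is_derive_eq; rewrite /GRing.scale /=; field: s2.
have pi2 : 0 < 2 * pi :> R by rewrite mulr_gt0 ?pi_gt0.
rewrite (Rintegral_derive pi2 dF).
- by rewrite /F mulr_natl sin2pi cos2pi sin0 cos0; field.
- by move=> x; apply: ex_derive.
Qed.

(** Covers the fidelity and its squared deviation, both of degree at most two in cos^2 theta and in
    cos^2 phi. The means of cos^2 and cos^4 are 1/3 and 1/5 for theta, weighted by sin theta, and
    1/2 and 3/8 for phi. *)
Lemma pure_average_poly (g : 'cV[C]_2 -> R) (a0 b0 c0 a2 b2 c2 a4 b4 c4 : R) :
  (forall theta phi, g (bloch theta phi) =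
     (a0 + b0 * cos phi ^+ 2 + c0 * cos phi ^+ 4) +
     (a2 + b2 * cos phi ^+ 2 + c2 * cos phi ^+ 4) * cos theta ^+ 2 +
     (a4 + b4 * cos phi ^+ 2 + c4 * cos phi ^+ 4) * cos theta ^+ 4) ->
  pure_average g = (a0 + a2 / 3 + a4 / 5) + (b0 + b2 / 3 + b4 / 5) / 2
    + 3 / 8 * (c0 + c2 / 3 + c4 / 5).
Proof.
move=> gE; rewrite /pure_average.
under eq_Rintegral => phi _.
  under eq_Rintegral => theta _ do rewrite gE.
  rewrite Rintegral_cos_sin.
  rewrite (_ : _ + _ = (2 * (a0 + a2 / 3 + a4 / 5)) +
     (2 * (b0 + b2 / 3 + b4 / 5)) * cos phi ^+ 2 +
     (2 * (c0 + c2 / 3 + c4 / 5)) * cos phi ^+ 4); last by field.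
  over.
rewrite Rintegral_cos4.
have pi0 := lt0r_neq0 (pi_gt0 R).
by move: (pi : R) pi0 => p p0; field.
Qed.

Lemma average_fidelityE (rho : 'M[C]_(2 * 2)) :
  average_fidelity rho = 2^-1 * (Re (\tr rho)
    - (correlation rho 0 0 + correlation rho 1 1 + correlation rho 2 2) / 3).
Proof.
rewrite /average_fidelity.
move: (fidelity_bloch rho); move: (Re _) (correlation rho 0 0) (correlation rho 1 1) (correlation rho 2 2) => c x y z fE.
rewrite (@pure_average_poly _ ((c - y) / 2) ((y - x) / 2) 0 ((y - z) / 2) ((x - y) / 2) 0 0 0 0).
  by field.
by move=> theta phi; rewrite fE !exprMn !sin2cos2; field.
Qed.

Lemma fidelity_stdE (rho : 'M[C]_(2 * 2)) :
  let T := correlation rho in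
  fidelity_std rho = Num.sqrt (90^-1 *
    ((T 0 0 - T 1 1) ^+ 2 + (T 0 0 - T 2 2) ^+ 2 + (T 1 1 - T 2 2) ^+ 2)).
Proof.
move=> T; rewrite /fidelity_std average_fidelityE; congr Num.sqrt.
move: (fidelity_bloch rho); rewrite /T; move: (Re _) (correlation rho 0 0) (correlation rho 1 1) (correlation rho 2 2) => c x y z fE {T}.
(* [P0] is the constant term of the fidelity minus its mean, after sin^2 is replaced by 1 - cos^2;
   the nine coefficients below are those of the square of that polynomial. *)
pose P0 := (x + z - 2 * y) / 6.
rewrite (@pure_average_poly _ (P0 ^+ 2) (2 * P0 * ((y - x) / 2)) (((y - x) / 2) ^+ 2)
  (2 * P0 * ((y - z) / 2)) (2 * (P0 * ((x - y) / 2) + ((y - x) / 2) * ((y - z) / 2)))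
  (2 * ((y - x) / 2) * ((x - y) / 2))
  (((y - z) / 2) ^+ 2) (2 * ((y - z) / 2) * ((x - y) / 2)) (((x - y) / 2) ^+ 2)).
  by rewrite /P0; field.
by move=> theta phi; rewrite fE !exprMn !sin2cos2 /P0; field.
Qed.

Lemma fidelity_std_eq0 (rho : 'M[C]_(2 * 2)) : fidelity_std rho = 0 ->
  correlation rho 1 1 = correlation rho 0 0 /\ correlation rho 2 2 = correlation rho 0 0.
Proof.
rewrite fidelity_stdE => /eqP; rewrite sqrtr_eq0.
move: (correlation rho 0 0) (correlation rho 1 1) (correlation rho 2 2) => x y z h.
have := (sqr_ge0 (x - y), sqr_ge0 (x - z), sqr_ge0 (y - z)) => -[[h1 h2] h3].
have /eqP : (x - y) ^+ 2 = 0 by lra.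
have /eqP : (x - z) ^+ 2 = 0 by lra.
by rewrite !sqrf_eq0 !subr_eq0 => /eqP -> /eqP ->.
Qed.
End Averages.

(** * Pauli expansions *)

Section Pauli.
Variable R : realType.
Local Notation C := R[i].

Lemma pauli_lift (i : 'I_3) : pauli R (lift ord0 i) = sigma R i. Proof. by []. Qed.

Lemma pauli_herm k : (pauli R k)^t* = pauli R k.
Proof.
apply: mx2_ext; rewrite adjE; move: k; elim/ord4P;
  rewrite !pauliE ?one2E ?mx2E ?conjC0 ?conjC1 //;
  by apply: complex_ext; rewrite ?ReIm /= ?oppr0 ?opprK.
Qed.

Lemma sigma_herm i : (sigma R i)^t* = sigma R i.
Proof. exact: pauli_herm. Qed.

Lemma mxtrace_pauli_mul k l : \tr (pauli R k *m pauli R l) = (k == l)%:R *+ 2.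
Proof.
rewrite /mxtrace sum2E !mxE !sum2E.
by move: k l; do 2! elim/ord4P; rewrite !pauliE ?one2E ?mx2E /=;
  apply: complex_ext; rewrite ?ReIm /= ?mulr1n ?mulr0n; ring.
Qed.

Lemma mxtrace_pauli k : \tr (pauli R k) = (k == 0)%:R *+ 2.
Proof. by rewrite -[in LHS](mulmx1 (pauli R k)) (mxtrace_pauli_mul k 0). Qed.

(** The coefficient is the trace of [delta_mx i j *m pauli R k], whence the swapped indices. *)
Lemma delta_pauli (i j : 'I_2) :
  delta_mx i j = 2^-1 *: \sum_k pauli R k j i *: pauli R k.
Proof.
have -> : 2^-1 = (2^-1 : R)%:C :> C by rewrite realcV realc_nat.
rewrite sum4E; apply: mx2_ext; rewrite mxE scalemxE !addmxE !scalemxE;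
by move: i j; do 2! elim/ord2P; rewrite !pauliE ?one2E ?mx2E /=;
  apply: complex_ext; rewrite ?ReIm /= ?mulr1n ?mulr0n; field.
Qed.

Lemma mxtrace_mul_delta n (A : 'M[C]_n) i j : \tr (A *m delta_mx j i) = A i j.
Proof.
rewrite /mxtrace (bigD1 i) //= [X in _ + X]big1 ?addr0 => [|k ki]; last first.
  by rewrite mxE big1 // => l _; rewrite mxE (negPf ki) andbF mulr0.
rewrite mxE (bigD1 j) //= [X in _ + X]big1 ?addr0 => [|l lj].
  by rewrite mxE !eqxx mulr1.
by rewrite mxE (negPf lj) mulr0.
Qed.

Lemma pauli_expansion (A : 'M[C]_2) : A = 2^-1 *: \sum_k \tr (A *m pauli R k) *: pauli R k.
Proof.
apply/matrixP => i j; rewrite -[LHS]mxtrace_mul_delta delta_pauli.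
rewrite scalemxE -scalemxAr mxtraceZ; congr (_ * _).
rewrite mulmx_sumr linear_sum summxE; apply: eq_bigr => k _.
by rewrite /= -scalemxAr mxtraceZ scalemxE mulrC.
Qed.

Lemma mxtrace_tens m n (A : 'M[C]_m) (B : 'M[C]_n) : \tr (A *t B) = \tr A * \tr B.
Proof.
rewrite /mxtrace big_tens_index mulr_suml; apply: eq_bigr => i _.
by rewrite mulr_sumr; apply: eq_bigr => a _; rewrite tensmxE.
Qed.

Lemma tensDl m n p q (A B : 'M[C]_(m, n)) (D : 'M[C]_(p, q)) :
  (A + B) *t D = A *t D + B *t D.
Proof.
apply/matrixP => x y; case: (mxtens_indexP x) => ? ?; case: (mxtens_indexP y) => ? ?.
by rewrite addmxE !tensmxE addmxE mulrDl.
Qed.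

Lemma tensDr m n p q (A B : 'M[C]_(m, n)) (D : 'M[C]_(p, q)) :
  D *t (A + B) = D *t A + D *t B.
Proof.
apply/matrixP => x y; case: (mxtens_indexP x) => ? ?; case: (mxtens_indexP y) => ? ?.
by rewrite addmxE !tensmxE addmxE mulrDr.
Qed.

Lemma tensZl m n p q c (A : 'M[C]_(m, n)) (D : 'M[C]_(p, q)) :
  (c *: A) *t D = c *: (A *t D).
Proof.
apply/matrixP => x y; case: (mxtens_indexP x) => ? ?; case: (mxtens_indexP y) => ? ?.
by rewrite scalemxE !tensmxE scalemxE mulrA.
Qed.

Lemma tensZr m n p q c (A : 'M[C]_(m, n)) (D : 'M[C]_(p, q)) :
  D *t (c *: A) = c *: (D *t A).
Proof.
apply/matrixP => x y; case: (mxtens_indexP x) => ? ?; case: (mxtens_indexP y) => ? ?.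
by rewrite scalemxE !tensmxE scalemxE mulrCA.
Qed.

Lemma tens_suml (I : finType) m n p q (A : I -> 'M[C]_(m, n)) (D : 'M[C]_(p, q)) :
  (\sum_i A i) *t D = \sum_i A i *t D.
Proof. by elim/big_rec2: _ => [|i x y _ <-]; rewrite ?tens0mx ?tensDl. Qed.

Lemma tens_sumr (I : finType) m n p q (A : I -> 'M[C]_(m, n)) (D : 'M[C]_(p, q)) :
  D *t (\sum_i A i) = \sum_i D *t A i.
Proof. by elim/big_rec2: _ => [|i x y _ <-]; rewrite ?tensmx0 ?tensDr. Qed.

(** Entries are traces against matrix units; a matrix unit of the tensor product is a product of
    matrix units, each a combination of Pauli matrices. *)
Lemma tens_pauli_inj (X Y : 'M[C]_(2 * 2)) :
  (forall k l, \tr (X *m (pauli R k *t pauli R l)) = \tr (Y *m (pauli R k *t pauli R l))) ->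
  X = Y.
Proof.
move=> XY; apply: tens_ext => i a j b.
rewrite -!mxtrace_mul_delta.
have -> : delta_mx (idx j b) (idx i a) = delta_mx j i *t delta_mx b a :> 'M[C]_(2 * 2).
  apply: tens_ext => i' a' j' b'; rewrite tensmxE !mxE !(can_eq (@mxtens_indexK 2 2)) !xpair_eqE.
  by rewrite -natrM mulnb andbACA.
rewrite !delta_pauli tensZl tensZr tens_suml -!scalemxAr !mulmx_sumr !mxtraceZ.
congr (_ * (_ * _)); rewrite !linear_sum; apply: eq_bigr => k _.
rewrite tens_sumr !mulmx_sumr !linear_sum; apply: eq_bigr => l _.
by rewrite /= tensZl tensZr -!scalemxAr !mxtraceZ XY.
Qed.

Lemma mxtrace_adj n (A : 'M[C]_n) : \tr (A^t*) = (\tr A)^*%R.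
Proof. by rewrite /mxtrace rmorph_sum; apply: eq_bigr => i _; rewrite adjE. Qed.

Lemma mxtrace_herm_real n (A B : 'M[C]_n) : A^t* = A -> B^t* = B ->
  (Re (\tr (A *m B)))%:C = \tr (A *m B).
Proof.
move=> hA hB; have : (\tr (A *m B))^*%R = \tr (A *m B).
  by rewrite -mxtrace_adj adjM hA hB mxtrace_mulC.
case: (\tr _) => x y [] /eqP; rewrite eq_sym -addr_eq0 -mulr2n mulrn_eq0 /= => /eqP ->.
by [].
Qed.

Lemma correlation_real (rho : 'M[C]_(2 * 2)) i j : rho^t* = rho ->
  (correlation rho i j)%:C = \tr (rho *m (sigma R i *t sigma R j)).
Proof.
by move=> hrho; rewrite [correlation _ _ _]mxE mxtrace_herm_real // adj_tens !sigma_herm.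
Qed.

Lemma unitaryP n (U : 'M[C]_n) : U \is unitarymx -> U *m U^t* = 1%:M /\ U^t* *m U = 1%:M.
Proof. by move=> /unitarymxP UU; split => //; apply: mulmx1C. Qed.

Lemma unitaryI n (U : 'M[C]_n) : U *m U^t* = 1%:M -> U \is unitarymx.
Proof. by move=> UU; apply/unitarymxP. Qed.

(** Heisenberg picture: cyclicity of the trace moves the unitaries onto the observables. *)
Lemma mxtrace_local_unitary U V rho (A B : 'M[C]_2) :
  \tr (local_unitary U V rho *m (A *t B)) =
  \tr (rho *m ((U^t* *m A *m U) *t (V^t* *m B *m V))).
Proof.
rewrite /local_unitary -!tensmx_mul adj_tens.
by rewrite -!mulmxA [LHS]mxtrace_mulC -!mulmxA.
Qed.

Lemma local_unitary_comp U V U' V' (rho : 'M[C]_(2 * 2)) :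
  local_unitary U' V' (local_unitary U V rho) = local_unitary (U' *m U) (V' *m V) rho.
Proof. by rewrite /local_unitary !adj_tens !adjM -!tensmx_mul !mulmxA. Qed.

Lemma tens11 m n : (1%:M : 'M[C]_m) *t (1%:M : 'M[C]_n) = 1%:M.
Proof.
apply/matrixP => x y; case: (mxtens_indexP x) => i a; case: (mxtens_indexP y) => j b.
by rewrite tensmxE !mxE (can_eq (@mxtens_indexK m n)) xpair_eqE -natrM mulnb.
Qed.

Lemma local_unitary1 (rho : 'M[C]_(2 * 2)) : local_unitary 1%:M 1%:M rho = rho.
Proof. by rewrite /local_unitary tens11 adjmx1 mul1mx mulmx1. Qed.

(** The conjugate A of a Pauli matrix is Hermitian, traceless and squares to the identity. Hence its
    Pauli coefficients are real, the identity component vanishes, and the trace of A^2, which is 2,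
    gives unit length. *)
Lemma rotated_sigma (U : 'M[C]_2) i : U \is unitarymx ->
  exists2 o : 'I_3 -> R, U^t* *m sigma R i *m U = \sum_j (o j)%:C *: sigma R j &
    \sum_j o j ^+ 2 = 1.
Proof.
move=> /unitaryP[UU' UU]; set A := _ *m U.
have hA : A^t* = A by rewrite /A !adjM adjK sigma_herm mulmxA.
have trA : \tr A = 0.
  by rewrite /A mxtrace_mulC mulmxA UU' mul1mx /sigma mxtrace_pauli eq_sym
    (negPf (neq_lift ord0 i)) mul0rn.
have AA : A *m A = 1%:M.
  have ss : sigma R i *m sigma R i = 1%:M.
    apply: mx2_ext; rewrite !mxE !sum2E; move: i {A hA trA}; elim/ord3P;
      rewrite !sigmaE !mx2E /=; apply: complex_ext; rewrite ?ReIm /= ?mulr1n ?mulr0n; ring.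
  by rewrite /A !mulmxA -[_ *m U *m U^t*]mulmxA UU' mulmx1 -[_ *m _ *m sigma R i]mulmxA ss mulmx1.
pose o j := 2^-1 * Re (\tr (A *m sigma R j)).
have oE j : (o j)%:C = 2^-1 * \tr (A *m sigma R j).
  by rewrite /o realcM mxtrace_herm_real ?sigma_herm // realcV realc_nat.
have AE : A = \sum_j (o j)%:C *: sigma R j.
  rewrite [LHS]pauli_expansion big_ord_recl /= [pauli R ord0]pauliE mulmx1 trA scale0r add0r.
  by rewrite scaler_sumr; apply: eq_bigr => j _; rewrite scalerA oE.
exists o => //; apply: (@complexI R).
have := congr1 (fun X => \tr X) AA; rewrite mxtrace1 => trAA.
have : 2^-1 * \tr (A *m A) = (\sum_j o j ^+ 2)%:C.
  rewrite [X in A *m X]AE mulmx_sumr linear_sum mulr_sumr.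
  rewrite rmorph_sum; apply: eq_bigr => j _ /=.
  by rewrite -scalemxAr mxtraceZ mulrCA -oE realcX expr2.
by rewrite trAA mulVf ?pnatr_eq0 // => <-.
Qed.
End Pauli.

(** * Canonical states *)

Section Canonical.
Variable R : realType.
Local Notation C := R[i].

Lemma mxtrace_canonical_pauli (s : 'rV[R]_3) t k l :
  \tr (canonical_state s t *m (pauli R k *t pauli R l)) =
  (k == 0)%:R * ((l == 0)%:R + \sum_i (s 0 i)%:C * (lift ord0 i == l)%:R)
  - t%:C * \sum_i (lift ord0 i == k)%:R * (lift ord0 i == l)%:R.
Proof.
have t11 : (1%:M : 'M[C]_(2 * 2)) = pauli R 0 *t pauli R 0 by rewrite -(tens11 R 2 2).
rewrite /canonical_state t11 [1%:M](_ : _ = pauli R 0) // tens_sumr.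
rewrite -scalemxAl mxtraceZ mulmxBl mulmxDl linearB linearD /= -scalemxAl.
rewrite !mulmx_suml mxtraceZ !linear_sum /= tensmx_mul mxtrace_tens !mxtrace_pauli_mul.
under eq_bigr do rewrite tensZr -scalemxAl mxtraceZ tensmx_mul mxtrace_tens !mxtrace_pauli_mul.
under [X in _ - _ * X]eq_bigr do rewrite tensmx_mul mxtrace_tens !mxtrace_pauli_mul.
rewrite realcV realc_nat ![0 == _]eq_sym !sum3E.
by field.
Qed.

Lemma correlation_canonical (s : 'rV[R]_3) t i j :
  correlation (canonical_state s t) i j = - (t *+ (i == j)).
Proof.
rewrite mxE -!pauli_lift mxtrace_canonical_pauli.
rewrite [_ == 0]eq_sym (negPf (neq_lift ord0 i)) mul0r sub0r.
under eq_bigr do rewrite !(inj_eq lift_inj).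
rewrite (bigD1 i) //= big1 ?addr0 => [|k ki]; last by rewrite (negPf ki) mul0r.
by rewrite eqxx mul1r -(realc_nat R) -realcM -realcN /= mulr_natr.
Qed.

(** Sixteen Pauli coefficients fix a state: the marginal condition gives those with identity on the
    second factor, the correlations give the nine products, and the remaining three are taken as
    [s]. *)
Lemma canonical_reconstruct (rho : 'M[C]_(2 * 2)) t : rho^t* = rho ->
  (forall A : 'M[C]_2, \tr (rho *m (A *t 1%:M)) = 2^-1 * \tr A) ->
  (forall i j, correlation rho i j = - (t *+ (i == j))) ->
  exists s, rho = canonical_state s t.
Proof.
move=> hrho marg corr.
exists (\row_i Re (\tr (rho *m (1%:M *t sigma R i)))).
apply: tens_pauli_inj => k l; rewrite mxtrace_canonical_pauli.
case: (unliftP ord0 l) => [l' ->|->]; last first.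
  rewrite [pauli R ord0]pauliE marg mxtrace_pauli big1 => [|i _]; last first.
    by rewrite eq_sym (negPf (neq_lift ord0 i)) mulr0.
  rewrite big1 => [|i _]; last by rewrite [_ == ord0]eq_sym (negPf (neq_lift ord0 i)) mulr0.
  rewrite [ord0 == 0]eqxx mulr1n addr0 mulr0 subr0 mulr1.
  by rewrite -[X in 2^-1 * X]mulr_natr mulrC mulfK //.
case: (unliftP ord0 k) => [k' ->|->].
  rewrite [_ == 0]eq_sym (negPf (neq_lift ord0 k')) mul0r sub0r !pauli_lift.
  rewrite -correlation_real // corr (bigD1 k') //= big1 ?addr0 => [|i ik]; last first.
    by rewrite (inj_eq lift_inj) (negPf ik) mul0r.
  by rewrite eqxx mul1r (inj_eq lift_inj) realcN -(realc_nat R) -realcM mulr_natr.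
rewrite eqxx mul1r [_ == 0]eq_sym (negPf (neq_lift ord0 l')) add0r.
rewrite [X in _ = _ - _ * X]big1 ?mulr0 ?subr0 => [|i _]; last first.
  by rewrite [_ == ord0]eq_sym (negPf (neq_lift ord0 i)) mul0r.
rewrite (bigD1 l') //= big1 ?addr0 => [|i il]; last first.
  by rewrite (inj_eq lift_inj) (negPf il) mulr0.
rewrite eqxx mulr1 mxE mxtrace_herm_real //.
by rewrite adj_tens sigma_herm adjmx1.
Qed.

(** Trace preservation gives [L (delta_mx i j)] the trace of a matrix unit, so the first reduced
    state is maximally mixed. *)
Lemma choi_marginal1 (L : 'M[C]_2 -> 'M[C]_2) (A : 'M[C]_2) : linear L ->
  trace_preserving L -> \tr (choi L *m (A *t 1%:M)) = 2^-1 * \tr A.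
Proof.
move=> linL tpL; rewrite choi_sum; last exact: linear_scalable.
rewrite -scalemxAl mxtraceZ; congr (_ * _).
rewrite mulmx_suml linear_sum; apply: eq_bigr => i _.
rewrite mulmx_suml linear_sum (bigD1 i) //= big1 ?addr0 => [|j ji].
  by rewrite tensmx_mul mxtrace_tens mulmx1 tpL mxtrace_mulC !mxtrace_mul_delta /mxtrace
    (bigD1 i) //= big1 ?addr0 => [|j ji]; rewrite mxE ?(negPf ji) ?eqxx ?mulr1.
rewrite tensmx_mul mxtrace_tens mulmx1 tpL /mxtrace [X in _ * X]big1 ?mulr0 // => k _.
by rewrite mxE; case: eqP => // ->; rewrite eq_sym (negPf ji).
Qed.

(** [L 1%:M] is twice the second reduced state of the Choi state, that is I + s . sigma. *)
Lemma canonical_unital (L : 'M[C]_2 -> 'M[C]_2) (s : 'rV[R]_3) t : linear L ->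
  choi L = canonical_state s t -> s = 0 -> L 1%:M = 1%:M.
Proof.
move=> linL cL s0; apply/matrixP => a b.
pose L' : {linear _ -> _} := HB.pack L (GRing.isLinear.Build _ _ _ _ L linL).
have -> : (1%:M : 'M[C]_2) = delta_mx 0 0 + delta_mx 1 1.
  by apply: mx2_ext; rewrite !mxE /= ?addr0 ?add0r.
have -> : L = L' by []. rewrite linearD /= addmxE.
have h i : L (delta_mx i i) a b = 2 * canonical_state s t (idx i a) (idx i b).
  by rewrite -cL choiE ?mulrA ?divff ?mul1r ?pnatr_eq0 //; exact: linear_scalable.
have z j : s 0 j = 0 by rewrite s0 mxE.
rewrite !h !canonical_stateE !z !eqxx !sigmaE realcV realc_nat.
rewrite (_ : (0 : R)%:C = 0) // !mul0r !addr0 addmxE ![(delta_mx _ _) _ _]mxE.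
by move: a b {h}; do 2! elim/ord2P; rewrite !mx2E /=; field.
Qed.

Lemma singlet_projector : PsiMinus R *m (PsiMinus R)^t* =
  (4^-1 : R)%:C *: (1%:M - \sum_i sigma R i *t sigma R i).
Proof.
apply: tens_ext => i a j b; rewrite mxE big_ord1 adjE !PsiMinusE.
rewrite scalemxE addmxE oppmxE sum3E !addmxE !tensmxE.
have -> : (1%:M : 'M[C]_(2 * 2)) (idx i a) (idx j b) = ((i == j) && (a == b))%:R.
  by rewrite mxE (can_eq (@mxtens_indexK 2 2)) xpair_eqE.
rewrite rmorphM /= conj_realc mulrACA -realcM sqrtV2.
rewrite !realcV !realc_nat.
have iE : 'i * 'i = -1 :> C by rewrite -expr2; exact: sqr_i.
have iE' : Complex 0 1 = 'i%R :> C by [].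
move: i a j b; do 4! elim/ord2P; rewrite !sigmaE !mx2E /=.
all: rewrite ?(mulr1n, mulr0n, mulr0, mul0r, mulr1, subr0, sub0r, conjC0, conjC1, rmorphN) ?iE' ?mulrNN ?mulrN ?mulNr ?iE /= ?conjC1.
all: by field.
Qed.

Lemma psd_correlation_ge (rho : 'M[C]_(2 * 2)) t : psd rho -> \tr rho = 1 ->
  (forall i j, correlation rho i j = - (t *+ (i == j))) -> - 3^-1 <= t.
Proof.
move=> rho0 tr1 corr; have hrho := psd_herm rho0.
have := rho0 (PsiMinus R); rewrite -trace_mx11 -mulmxA mxtrace_mulC -mulmxA singlet_projector.
rewrite -scalemxAr mxtraceZ mulmxBr mulmx1 linearB /= tr1.
have -> : \tr (rho *m \sum_i sigma R i *t sigma R i) =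
    \sum_i \tr (rho *m (sigma R i *t sigma R i)).
  by rewrite mulmx_sumr linear_sum.
rewrite sum3E -!correlation_real // !corr !eqxx !mulr1n.
rewrite (_ : _ * _ = (4^-1 * (1 + 3 * t))%:C); last by rewrite !realcE; ring.
by rewrite ler0c; lra.
Qed.

Lemma trace_local_unitary (U V : 'M[C]_2) (rho : 'M[C]_(2 * 2)) : U \is unitarymx ->
  V \is unitarymx -> \tr (local_unitary U V rho) = \tr rho.
Proof.
move=> /unitaryP[_ UU] /unitaryP[_ VV].
by rewrite /local_unitary mxtrace_mulC mulmxA adj_tens tensmx_mul UU VV tens11 mul1mx.
Qed.

(** Each rotated diagonal entry is - t times the inner product of two unit vectors. *)
Lemma correlation_rotated_ge (rho : 'M[C]_(2 * 2)) t U V : rho^t* = rho ->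
  (forall i j, correlation rho i j = - (t *+ (i == j))) ->
  U \is unitarymx -> V \is unitarymx ->
  - 3 * `|t| <= \sum_i correlation (local_unitary U V rho) i i.
Proof.
move=> hrho corr uU uV.
have H i : exists o p : 'I_3 -> R, [/\ \sum_j o j ^+ 2 = 1, \sum_j p j ^+ 2 = 1 &
   correlation (local_unitary U V rho) i i = - t * \sum_j o j * p j].
  have [u oE o1] := rotated_sigma i uU; have [p pE p1] := rotated_sigma i uV.
  exists u, p; split => //; rewrite mxE mxtrace_local_unitary oE pE.
  rewrite (_ : \tr _ = (- t * \sum_j u j * p j)%:C) //.
  rewrite realcM (rmorph_sum (real_complex R)) mulr_sumr tens_suml mulmx_sumr linear_sum.
  apply: eq_bigr => j _ /=.
  rewrite tens_sumr mulmx_sumr linear_sum (bigD1 j) //= big1 ?addr0 => [|k kj].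
    rewrite tensZl tensZr -!scalemxAr !mxtraceZ -correlation_real // corr eqxx.
    by rewrite mulr1n !realcE; ring.
  rewrite tensZl tensZr -!scalemxAr !mxtraceZ -correlation_real // corr eq_sym.
  by rewrite (negPf kj) mulr0n oppr0 !mulr0.
have bnd i : - `|t| <= correlation (local_unitary U V rho) i i.
  have [ o' [p [n1 p1 ->]]] := H i.
  (* Cauchy-Schwarz for unit vectors, from the squared lengths of their sum and difference. *)
  have : `|\sum_j o' j * p j| <= 1.
    rewrite ler_norml; move: n1 p1; rewrite !sum3E => n1 p1.
    have := (sqr_ge0 (o' 0 + p 0), sqr_ge0 (o' 1 + p 1), sqr_ge0 (o' 2 + p 2)).
    have := (sqr_ge0 (o' 0 - p 0), sqr_ge0 (o' 1 - p 1), sqr_ge0 (o' 2 - p 2)).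
    move=> [[? ?] ?] [[? ?] ?]; apply/andP; split; nra.
  move=> h; have : `|- t * \sum_j o' j * p j| <= `|t| by rewrite normrM normrN ler_piMr.
  by rewrite ler_norml => /andP[].
by rewrite sum3E; have := (bnd 0, bnd 1, bnd 2) => -[[? ?] ?]; lra.
Qed.
End Canonical.

(** * Channels useful for teleportation *)

Section Main.
Variable R : realType.
Local Notation C := R[i].

(** The supremum is never evaluated: a number below it is exceeded at some pair of unitaries, the
    set being nonempty by the identity pair. *)
Lemma max_average_fidelity_gt (rho : 'M[C]_(2 * 2)) c : c < max_average_fidelity rho ->
  exists U V, [/\ U \is unitarymx, V \is unitarymx &
    c < average_fidelity (local_unitary U V rho)].
Proof.
have u1 : (1%:M : 'M[C]_2) \is unitarymx by apply: unitaryI; rewrite adjmx1 mulmx1.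
rewrite /max_average_fidelity => /sup_gt[]; first by exists (average_fidelity (local_unitary 1%:M 1%:M rho)), 1%:M, 1%:M.
by move=> f [U [V [uU uV fE]]] h; exists U, V; split; [exact: uU|exact: uV|rewrite -fE].
Qed.

Lemma isotropic_useful (rho : 'M[C]_(2 * 2)) t U V : psd rho -> \tr rho = 1 ->
  (forall i j, correlation rho i j = - (t *+ (i == j))) ->
  U \is unitarymx -> V \is unitarymx ->
  2 / 3 < average_fidelity (local_unitary U V rho) -> 1 / 3 < t.
Proof.
move=> rho0 tr1 corr uU uV; rewrite average_fidelityE (trace_local_unitary _ uU uV) tr1 cRe1.
have t3 := psd_correlation_ge rho0 tr1 corr.
have := correlation_rotated_ge (psd_herm rho0) corr uU uV; rewrite sum3E => h1 h2.
have : 1 < 3 * `|t| by lra.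
by case: (ger0P t) => t0 h3; lra.
Qed.

Lemma psd_local_unitary U V (rho : 'M[C]_(2 * 2)) : psd rho -> psd (local_unitary U V rho).
Proof. exact: psd_congr. Qed.

Lemma unitmx_local_unitary U V (rho : 'M[C]_(2 * 2)) : U \is unitarymx ->
  V \is unitarymx -> rho \in unitmx -> local_unitary U V rho \in unitmx.
Proof.
move=> uU uV rhoU; have [/unitaryP[UU _] /unitaryP[VV _]] := (uU, uV).
have : (U *t V) *m (U *t V)^t* = 1%:M.
  by rewrite adj_tens tensmx_mul UU VV tens11.
by move=> /mulmx1_unit[h1 h2]; rewrite /local_unitary !unitmx_mul h1 h2 rhoU.
Qed.

Lemma local_unitary_adj U V (rho : 'M[C]_(2 * 2)) : U \is unitarymx ->
  V \is unitarymx -> local_unitary (U^t*) (V^t*) (local_unitary U V rho) = rho.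
Proof.
by move=> /unitaryP[_ UU] /unitaryP[_ VV]; rewrite local_unitary_comp UU VV local_unitary1.
Qed.

(** * Bound on the vector s from positivity and full rank *)

Lemma enorm_ge0 (s : 'rV[R]_3) : 0 <= enorm s. Proof. exact: sqrtr_ge0. Qed.

Lemma enorm_eq0 (s : 'rV[R]_3) : enorm s = 0 -> s = 0.
Proof.
move=> s0; have := sqr_enorm s; rewrite s0 expr0n /= => h.
have := (sqr_ge0 (s 0 0), sqr_ge0 (s 0 1), sqr_ge0 (s 0 2)) => -[[h0 h1] h2].
apply/matrixP => i j; rewrite ord1 mxE; apply/eqP; rewrite -sqrf_eq0; apply/eqP.
by move: j; elim/ord3P; lra.
Qed.

(** The two rows of (s . sigma) e = - |s| e for e = (x, y), solved for s_3 x and s_3 y so that they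
    can serve as rewriting rules. *)
Lemma bloch_eigenvector (s : 'rV[R]_3) : exists x y : C,
  [/\ (x != 0) || (y != 0),
   (s 0 2)%:C * x = - (enorm s)%:C * x - ((s 0 0)%:C - 'i * (s 0 1)%:C) * y &
   (s 0 2)%:C * y = (enorm s)%:C * y + ((s 0 0)%:C + 'i * (s 0 1)%:C) * x].
Proof.
have hn := sqr_enorm s; have i2 : 'i ^+ 2 = -1 :> C by exact: sqr_i.
have hn' : (s 0 0)%:C ^+ 2 = (enorm s)%:C ^+ 2 - (s 0 1)%:C ^+ 2 - (s 0 2)%:C ^+ 2 :> C.
  have h : s 0 0 ^+ 2 = enorm s ^+ 2 - s 0 1 ^+ 2 - s 0 2 ^+ 2 by rewrite hn; ring.
  by rewrite -realcX h !realcE.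
(* The eigenvector (s_1 - i s_2, - (|s| + s_3)) degenerates to zero exactly when |s| + s_3 = 0; then
   s . sigma = - |s| sigma_3, and (1, 0) is taken instead. *)
have [ns|ns] := eqVneq (enorm s + s 0 2) 0.
  have h : s 0 0 ^+ 2 + s 0 1 ^+ 2 = 0.
    have e : s 0 2 = - enorm s by apply/eqP; rewrite -addr_eq0 addrC ns.
    by move: hn; rewrite e sqrrN; lra.
  have [a0 b0] : s 0 0 = 0 /\ s 0 1 = 0.
    by move/eqP: h; rewrite paddr_eq0 ?sqr_ge0 // !sqrf_eq0 => /andP[/eqP -> /eqP ->].
  exists 1, 0; rewrite oner_neq0 a0 b0; split => //.
  - have -> : s 0 2 = - enorm s by apply/eqP; rewrite -addr_eq0 addrC ns.
    by rewrite realcN; ring.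
  - by rewrite (_ : (0 : R)%:C = 0) //; ring.
exists ((s 0 0)%:C - 'i * (s 0 1)%:C), (- (enorm s + s 0 2)%:C); split.
- by rewrite oppr_eq0 realc_eq0 ns orbT.
- by rewrite realcD; ring.
- by rewrite realcD; ring: i2 hn'.
Qed.

Lemma canonical_bound (s : 'rV[R]_3) t : psd (canonical_state s t) ->
  canonical_state s t \in unitmx -> enorm s < 1 - t.
Proof.
move=> psd_s unit_s; have [x [y [xy0 ex ey]]] := bloch_eigenvector s.
pose e : 'cV[C]_2 := \col_i (if i == 0 then x else y).
have e0 : e 0 0 = x by rewrite mxE.
have e1 : e 1 0 = y by rewrite mxE.
pose v : 'cV[C]_(2 * 2) := e *t e.
pose l : R := (1 - t - enorm s) / 4.
(* On the symmetric vector e (x) e the sum of the sigma_i (x) sigma_i acts as the identity, while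
   the local term multiplies it by - |s|. *)
have vE : canonical_state s t *m v = l%:C *: v.
  apply/matrixP => k z; rewrite (ord1 z); case: (mxtens_indexP k) => i a {k z}.
  rewrite mxE big_tens_index !sum2E scalemxE (tens_colE e e i a).
  rewrite !(tens_colE e e) !canonical_stateE e0 e1.
  rewrite /l (_ : (_ / 4)%:C = (4^-1 : R)%:C * (1 - t%:C - (enorm s)%:C)); last first.
    by rewrite !realcE mulrC.
  have iE' : Complex 0 1 = 'i%R :> C by [].
  have i2 : 'i ^+ 2 = -1 :> C by exact: sqr_i.
  move: i a; do 2! elim/ord2P; rewrite !sigmaE !mx2E /= ?e0 ?e1 ?mulr1n ?mulr0n ?iE'; first [ring: ex i2 | ring: ey i2].
have v0 : v != 0.
  apply/negP => /eqP /matrixP vz; move/orP: xy0 => [|] /negP; apply; apply/eqP.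
    by have := vz (idx 0 0) 0; rewrite (tens_colE e e) e0 mxE => /eqP; rewrite mulf_eq0 orbb => /eqP.
  by have := vz (idx 1 1) 0; rewrite (tens_colE e e) e1 mxE => /eqP; rewrite mulf_eq0 orbb => /eqP.
have l0 : l != 0.
  apply: contraNneq v0 => l0; rewrite -(mulKmx unit_s v) vE l0 scale0r mulmx0 eqxx //.
have := psd_s v; rewrite -mulmxA vE -scalemxAr mxE mxE.
have [k vk] : exists k, v k 0 != 0.
  apply/existsP; apply: contraR v0; rewrite negb_exists => /forallP vz; apply/eqP/matrixP => k z.
  by rewrite ord1 [RHS]mxE; apply/eqP; have := vz k; rewrite negbK.
rewrite (bigD1 k) //= adjE; set S := \sum_(_ | _) _.
have S0 : 0 <= S.
  by rewrite /S; apply: sumr_ge0 => j _; rewrite adjE mulrC mul_conjC_ge0.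
have vk0 : 0 < (v k 0)^*%R * v k 0 by rewrite mulrC mul_conjC_gt0.
rewrite (pmulr_lge0 _ (ltr_pwDl vk0 S0)) ler0c => l1.
have : 0 < l by rewrite lt0r l0.
by rewrite /l; lra.
Qed.

Lemma canonical_admissible (L : 'M[C]_2 -> 'M[C]_2) (s : 'rV[R]_3) t : linear L ->
  choi L = canonical_state s t -> L 1%:M <> 1%:M -> psd (canonical_state s t) ->
  canonical_state s t \in unitmx -> 1 / 3 < t -> admissible s t.
Proof.
move=> linL cL nu p u t3; have b := canonical_bound p u.
have n0 : 0 < enorm s.
  rewrite lt0r enorm_ge0 andbT; apply/eqP => /enorm_eq0 s0.
  exact/nu/(canonical_unital linL cL s0).
by split => //; lra.
Qed.

(** * Rotations W (x) W of canonical states *)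

Lemma local_unitary_canonical (W : 'M[C]_2) (s : 'rV[R]_3) t : W *m W^t* = 1%:M ->
  local_unitary W W (canonical_state s t) = (4^-1 : R)%:C *: (1%:M
    + 1%:M *t (\sum_i (s 0 i)%:C *: (W *m sigma R i *m W^t*))
    - t%:C *: \sum_i (W *m sigma R i *m W^t*) *t (W *m sigma R i *m W^t*)).
Proof.
move=> WW; rewrite /canonical_state.
have lin : linear (local_unitary W W).
  by move=> c X Y; rewrite /local_unitary mulmxDr mulmxDl -scalemxAr -scalemxAl.
pose L : {linear _ -> _} := HB.pack (local_unitary W W) (GRing.isLinear.Build _ _ _ _ _ lin).
have tE (A B : 'M[C]_2) : L (A *t B) = (W *m A *m W^t*) *t (W *m B *m W^t*).
  by rewrite /= /local_unitary adj_tens !tensmx_mul.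
have -> : local_unitary W W = L by [].
have L1 : L 1%:M = 1%:M by rewrite -tens11 tE !mulmx1 WW.
rewrite linearZ linearB linearD linearZ L1 tE mulmx1 WW.
congr (_ *: (_ + _ *t _ - _ *: _)).
  by rewrite mulmx_sumr mulmx_suml; apply: eq_bigr => i _; rewrite -scalemxAr -scalemxAl.
by rewrite linear_sum; apply: eq_bigr => i _; rewrite tE.
Qed.

Lemma canonical_rotate (W : 'M[C]_2) (s s' : 'rV[R]_3) t : W *m W^t* = 1%:M ->
  \sum_i (s 0 i)%:C *: (W *m sigma R i *m W^t*) = \sum_i (s' 0 i)%:C *: sigma R i ->
  \sum_i (W *m sigma R i *m W^t*) *t (W *m sigma R i *m W^t*) =
    \sum_i sigma R i *t sigma R i ->
  local_unitary W W (canonical_state s t) = canonical_state s' t.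
Proof. move=> WW e1 e2; rewrite (local_unitary_canonical s t WW) e1 e2; reflexivity. Qed.

Lemma mul_mx2 (a b c d a' b' c' d' : C) : mx2 a b c d *m mx2 a' b' c' d' =
  mx2 (a * a' + b * c') (a * b' + b * d') (c * a' + d * c') (c * b' + d * d').
Proof. by apply: mx2_ext; rewrite [LHS]mxE sum2E !mx2E. Qed.

Lemma opp_mx2 (a b c d : C) : - mx2 a b c d = mx2 (- a) (- b) (- c) (- d).
Proof. by apply: mx2_ext; rewrite oppmxE !mx2E. Qed.

Lemma tensNN (A : 'M[C]_2) : (- A) *t (- A) = A *t A.
Proof. by rewrite -scaleN1r tensZl tensZr scalerA mulrNN mulr1 scale1r. Qed.

Lemma row3E (x y z : R) : let r : 'rV[R]_3 := \row_j nth 0 [:: x; y; z] j in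
  (r 0 0 = x) * (r 0 1 = y) * (r 0 2 = z).
Proof. by rewrite /= !mxE. Qed.

(* Conjugation by sigma_1. *)
Lemma canonical_flip (s : 'rV[R]_3) t :
  exists2 W : 'M[C]_2, W \is unitarymx & local_unitary W W (canonical_state s t) =
    canonical_state (\row_j nth 0 [:: s 0 0; - s 0 1; - s 0 2] j) t.
Proof.
pose W : 'M[C]_2 := mx2 0 1 1 0.
have Wh : W^t* = W.
  by apply: mx2_ext; rewrite adjE !mx2E ?conjC0 ?conjC1.
have WW : W *m W^t* = 1%:M.
  by rewrite Wh mul_mx2; apply: mx2_ext; rewrite !mx2E !one2E; ring.
have W0 : W *m sigma R 0 *m W^t* = sigma R 0.
  by rewrite Wh !sigmaE !mul_mx2; congr (mx2 _ _ _ _); ring.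
have W1 : W *m sigma R 1 *m W^t* = - sigma R 1.
  by rewrite Wh !sigmaE opp_mx2 !mul_mx2; congr (mx2 _ _ _ _); rewrite ?(mul0r, mulr0, mul1r, mulr1, addr0, add0r, opprK, oppr0).
have W2 : W *m sigma R 2 *m W^t* = - sigma R 2.
  by rewrite Wh !sigmaE opp_mx2 !mul_mx2; congr (mx2 _ _ _ _); ring.
exists W; first exact: unitaryI.
apply: (canonical_rotate _ WW); rewrite !sum3E W0 W1 W2 ?tensNN; last by reflexivity.
by rewrite !row3E realcN realcN !scalerN !scaleNr; reflexivity.
Qed.

(** Conjugation by the Hadamard matrix exchanges sigma_1 and sigma_3 and negates sigma_2. *)
Lemma canonical_hadamard (s : 'rV[R]_3) t :
  exists2 W : 'M[C]_2, W \is unitarymx & local_unitary W W (canonical_state s t) =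
    canonical_state (\row_j nth 0 [:: s 0 2; - s 0 1; s 0 0] j) t.
Proof.
(* The square root of 2 is kept as an abstract atom, so that [field] works with w^2 = 2 alone. *)
have [w [conj_w w2 w0]] : exists w : C, [/\ w^-1^*%R = w^-1, w ^+ 2 = 2 & w != 0].
  exists (Num.sqrt 2)%:C; split; first by rewrite -realcV conj_realc.
    by rewrite -realcX sqr_sqrtr // realc_nat.
  by rewrite realc_eq0 sqrtr_eq0 -ltNge.
pose W : 'M[C]_2 := mx2 w^-1 w^-1 w^-1 (- w^-1).
have Wh : W^t* = W.
  by apply: mx2_ext; rewrite adjE !mx2E ?rmorphN /= ?conj_w.
have WW : W *m W^t* = 1%:M.
  by rewrite Wh mul_mx2; apply: mx2_ext; rewrite !mx2E !one2E; field: w2.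
have W0 : W *m sigma R 0 *m W^t* = sigma R 2.
  by rewrite Wh !sigmaE !mul_mx2; congr (mx2 _ _ _ _); field: w2.
have W1 : W *m sigma R 1 *m W^t* = - sigma R 1.
  have iE : Complex 0 1 = 'i%R :> C by [].
  by rewrite Wh !sigmaE opp_mx2 !mul_mx2; congr (mx2 _ _ _ _); rewrite ?iE; field: w2.
have W2 : W *m sigma R 2 *m W^t* = sigma R 0.
  by rewrite Wh !sigmaE !mul_mx2; congr (mx2 _ _ _ _); field: w2.
exists W; first exact: unitaryI.
apply: (canonical_rotate _ WW); rewrite !sum3E W0 W1 W2 ?tensNN.
  rewrite !row3E realcN !scalerN !scaleNr.
  by rewrite [LHS]addrC [X in _ + X]addrC addrA; reflexivity.
by rewrite [LHS]addrC [X in _ + X]addrC addrA; reflexivity.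
Qed.

(* With s_1 or s_2 nonzero, s_3 >= 0 is sufficient, and it is reached by a flip;
   if s is along the third axis, the Hadamard matrix moves it to the first. *)
Lemma generic_rotation (s : 'rV[R]_3) t : s != 0 -> 0 < t ->
  exists (W : 'M[C]_2) s', [/\ W \is unitarymx, generic s' t &
    local_unitary W W (canonical_state s t) = canonical_state s' t].
Proof.
move=> s0 t0.
have [/eqP z|z] := eqVneq (s 0 0 ^+ 2 + s 0 1 ^+ 2) 0.
  move: z; rewrite paddr_eq0 ?sqr_ge0 // !sqrf_eq0 => /andP[/eqP z0 /eqP z1].
  have z2 : s 0 2 != 0.
    by apply: contraNneq s0 => z2; apply/eqP/matrixP => i j; rewrite ord1 mxE; move: j; elim/ord3P.
  have [W uW WE] := canonical_hadamard s t.
  exists W; eexists; split; [exact: uW| |exact: WE].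
  by split; rewrite ?sqr_enorm !mxE /= ?z2 // z0 z1 oppr0 expr0n /= mulr0 mul0r !addr0 subr0 sqrf_eq0.
have m0 : 0 < s 0 0 ^+ 2 + s 0 1 ^+ 2 by rewrite lt0r z addr_ge0 ?sqr_ge0.
have z' : (s 0 0 != 0) || (s 0 1 != 0).
  by move: z; rewrite paddr_eq0 ?sqr_ge0 // !sqrf_eq0 negb_and.
have [s2|s2] := leP 0 (s 0 2).
  have u1 : (1%:M : 'M[C]_2) \is unitarymx by apply: unitaryI; rewrite adjmx1 mulmx1.
  exists 1%:M, s; split; [exact: u1| |exact: local_unitary1].
  by split; rewrite ?sqr_enorm // lt0r_neq0 //; nra.
have [W uW WE] := canonical_flip s t.
exists W; eexists; split; [exact: uW| |exact: WE].
split; rewrite ?sqr_enorm !mxE /= ?oppr_eq0 // lt0r_neq0 //; nra.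
Qed.

(** * Reduction of a useful channel to the canonical form *)

Lemma useful_rotation (rho : 'M[C]_(2 * 2)) : psd rho -> \tr rho = 1 ->
  useful_for_UQT rho -> exists U V t, [/\ U \is unitarymx, V \is unitarymx, 1 / 3 < t &
    forall i j, correlation (local_unitary U V rho) i j = - (t *+ (i == j))].
Proof.
move=> rho0 tr1 [/max_average_fidelity_gt[U' [V' [uU' uV' avg]]]].
case=> rhoC [[U [V [uU uV rhoCE]]] diag _ _] std0.
have [c1 c2] := fidelity_std_eq0 (esym std0).
pose t := - correlation rhoC 0 0.
have corr i j : correlation rhoC i j = - (t *+ (i == j)).
  have [<-|ij] := eqVneq i j; last first.
    by rewrite mulr0n oppr0; apply: (is_diag_mxP diag); rewrite (inj_eq val_inj).
  by rewrite mulr1n /t opprK; move: i; elim/ord3P.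
exists U, V, t; rewrite -rhoCE.
suff t3 : 1 / 3 < t by split; [exact: uU|exact: uV|exact: t3|exact: corr].
(* The unitaries with average fidelity above 2/3 refer to [rho]; composed with the inverse of the
   canonical rotation they act on [rhoC], whose correlation matrix is scalar. *)
have rhoE : rho = local_unitary (U^t*) (V^t*) rhoC by rewrite rhoCE local_unitary_adj.
rewrite rhoE local_unitary_comp in avg.
have uU2 : U' *m U^t* \is unitarymx.
  by apply: mul_unitarymx; [exact: uU'|rewrite trmxC_unitary; exact: uU].
have uV2 : V' *m V^t* \is unitarymx.
  by apply: mul_unitarymx; [exact: uV'|rewrite trmxC_unitary; exact: uV].
apply: (isotropic_useful _ _ corr uU2 uV2 avg).
  by rewrite rhoCE; exact: psd_local_unitary rho0.
by rewrite rhoCE (trace_local_unitary rho uU uV) tr1.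
Qed.

Lemma trmx_unitaryP (U : 'M[C]_2) : U \is unitarymx -> U^T *m U^T^t* = 1%:M /\ U^T^t* *m U^T = 1%:M.
Proof. by rewrite -trmx_unitary => /unitaryP. Qed.

Lemma rotate_tp (U V : 'M[C]_2) L : U \is unitarymx -> V \is unitarymx ->
  trace_preserving L -> trace_preserving (rotate U V L).
Proof.
move=> /trmx_unitaryP[_ UU] /unitaryP[_ VV] tpL X; rewrite /rotate.
by rewrite mxtrace_mulC mulmxA VV mul1mx tpL mxtrace_mulC mulmxA UU mul1mx.
Qed.

Lemma rotate_unital (U V : 'M[C]_2) L : U \is unitarymx -> V \is unitarymx ->
  unital (rotate U V L) -> unital L.
Proof.
move=> /trmx_unitaryP[UU _] /unitaryP[VV VV']; rewrite /unital /rotate mulmx1 UU => e.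
have := congr1 (fun X => V^t* *m X *m V) e.
by rewrite !mulmxA VV' mul1mx -mulmxA VV' !mulmx1 VV'.
Qed.

Lemma kraus_of_canonical (L : 'M[C]_2 -> 'M[C]_2) (s : 'rV[R]_3) t : linear L ->
  choi L = canonical_state s t -> admissible s t -> generic s t ->
  L =1 kraus_map (kraus s t).
Proof.
move=> linL cL adm gen; apply: (choi_inj linL); first exact: kraus_map_linear.
by rewrite cL choi_kraus.
Qed.

Lemma mxtrace_choi (L : 'M[C]_2 -> 'M[C]_2) : linear L -> trace_preserving L ->
  \tr (choi L) = 1.
Proof.
move=> linL tpL; rewrite -[choi L]mulmx1 -(tens11 R 2 2) choi_marginal1 // mxtrace1.
by rewrite mulVf // pnatr_eq0.
Qed.

Lemma uqt_canonical_form (L : {linear 'M[C]_2 -> 'M[C]_2}) : nonunital_rank4_UQT L ->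
  exists (U V : 'M[C]_2) (s : 'rV[R]_3) (t : R),
    [/\ U \is unitarymx, V \is unitarymx, admissible s t, generic s t &
        local_unitary U V (choi L) = canonical_state s t].
Proof.
move=> [[cpL tpL] nu rk useful].
have linL : linear L by exact: linearP.
have psdL := psd_choi cpL.
(* Rank four means invertible, a form that is stable under local unitaries. *)
have unitL : choi L \in unitmx by rewrite -row_free_unit /row_free rk.
have [U [V [t [uU uV t3 corr]]]] := useful_rotation psdL (mxtrace_choi linL tpL) useful.
have linUV := rotate_linear U V linL.
have cUV := choi_rotate U V linL.
have [s0 s0E] : exists s, local_unitary U V (choi L) = canonical_state s t.
  apply: canonical_reconstruct corr; first exact/psd_herm/psd_local_unitary.
  move=> A; rewrite -cUV; exact: choi_marginal1 linUV (rotate_tp uU uV tpL).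
have s0_neq0 : s0 != 0.
  apply/eqP => s00; apply/nu/(rotate_unital uU uV).
  exact: canonical_unital linUV (etrans cUV s0E) s00.
(* The second rotation changes only s; merged with the first, it presents the state as that of a
   single rotated channel, for which admissibility is then shown. *)
have [|W [s [uW gen WE]]] := @generic_rotation s0 t s0_neq0; first by lra.
rewrite -s0E local_unitary_comp in WE.
have uWU : W *m U \is unitarymx := mul_unitarymx uW uU.
have uWV : W *m V \is unitarymx := mul_unitarymx uW uV.
exists (W *m U), (W *m V), s, t.
suff adm : admissible s t by split; [exact: uWU|exact: uWV|exact: adm|exact: gen|exact: WE].
apply: canonical_admissible (rotate_linear (W *m U) (W *m V) linL) _ _ _ _ t3.
- exact: etrans (choi_rotate _ _ linL) WE.
- by move=> u1; apply/nu/(rotate_unital uWU uWV u1).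
- by rewrite -WE; exact: psd_local_unitary psdL.
- by rewrite -WE; exact: unitmx_local_unitary uWU uWV unitL.
Qed.

(** Here [t] is prescribed, so [1 / 3 < t] is read off the correlation matrix of the Choi state
    itself, which is already - t times the identity. *)
Lemma canonical_channel_admissible (L : {linear 'M[C]_2 -> 'M[C]_2}) s t :
  nonunital_rank4_UQT L -> choi L = canonical_state s t -> admissible s t.
Proof.
move=> [[cpL tpL] nu rk [/max_average_fidelity_gt[U [V [uU uV avg]]] _]] cL.
have linL : linear L by exact: linearP.
have psdL := psd_choi cpL.
have unitL : choi L \in unitmx by rewrite -row_free_unit /row_free rk.
have corr i j : correlation (choi L) i j = - (t *+ (i == j)).
  by rewrite cL correlation_canonical.
have t3 := isotropic_useful psdL (mxtrace_choi linL tpL) corr uU uV avg.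
rewrite cL in psdL unitL.
exact: canonical_admissible linL cL nu psdL unitL t3.
Qed.

(** * Completeness and non-unitality of the Kraus operators *)

Lemma kraus_sum_adj (s : 'rV[R]_3) t : admissible s t -> generic s t ->
  \sum_k (kraus s t k)^t* *m kraus s t k = 1%:M.
Proof.
move=> adm gen; apply/matrixP => j i.
(* The sum is twice the transpose of the first reduced state of the Choi state, hence computable
   from [canonical_state]. *)
transitivity (2 * \sum_a choi (kraus_map (kraus s t)) (idx i a) (idx j a)).
  rewrite summxE mulr_sumr.
  under [RHS]eq_bigr do rewrite choi_kraus_map mulrA divff ?mul1r ?pnatr_eq0 //.
  rewrite exchange_big; apply: eq_bigr => k _ /=; rewrite mxE; apply: eq_bigr => a _.
  by rewrite adjE mulrC.
have -> : 2 = (2 : R)%:C :> C by rewrite realc_nat.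
rewrite choi_kraus // sum2E !canonical_stateE !sigmaE.
have iE : Complex 0 1 = 'i%R :> C by [].
by move: i j; do 2! elim/ord2P; rewrite !mx2E !one2E /= ?mulr1n ?mulr0n ?iE !realcE; field.
Qed.

(** The sum is the image of the identity, that is I + s . sigma; its entry s_1 - i s_2 is nonzero by
    genericity. *)
Lemma kraus_sum_mul_adj (s : 'rV[R]_3) t : admissible s t -> generic s t ->
  \sum_k kraus s t k *m (kraus s t k)^t* <> 1%:M.
Proof.
move=> adm gen e.
have e1 : kraus_map (kraus s t) 1%:M = 1%:M.
  by rewrite /kraus_map -[RHS]e; apply: eq_bigr => k _; rewrite mulmx1.
have h a b : \sum_i canonical_state s t (idx i a) (idx i b) = 2^-1 * (1%:M : 'M[C]_2) a b.
  rewrite -choi_kraus // -e1 /kraus_map summxE sum2E !choi_kraus_map -mulrDr -big_split.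
  congr (_ * _); apply: eq_bigr => k _.
  by rewrite mulmx1 mxE sum2E !adjE.
have [_ _ n0 _] := adm; have [z _] := gen.
have iE : Complex 0 1 = 'i%R :> C by [].
have i2 : 'i ^+ 2 = -1 :> C by exact: sqr_i.
have := h 0 1; rewrite sum2E !canonical_stateE !sigmaE !mx2E !one2E /= ?mulr1n ?mulr0n ?iE => h01.
have : (s 0 0)%:C - 'i * (s 0 1)%:C = 0 :> C.
  have -> : (s 0 0)%:C - 'i * (s 0 1)%:C = 2 * (2^-1 * 0) :> C.
    by rewrite -h01 !realcE; field.
  by rewrite !mulr0.
move=> /[dup] /(congr1 (@complex.Re R)) + /(congr1 (@complex.Im R)).
rewrite !ReIm /= => a0 b0; move: z.
have -> : s 0 0 = 0 by lra.
have -> : s 0 1 = 0 by lra.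
by rewrite eqxx.
Qed.
End Main.

Theorem mainTheorem10 (R : realType) :
  (* every channel of the class can be brought by local unitaries on its final
     state to the canonical representation, with the given Kraus operators *)
  (forall L : {linear 'M[R[i]]_2 -> 'M[R[i]]_2}, nonunital_rank4_UQT L ->
    exists (U V : 'M[R[i]]_2) (s : 'rV[R]_3) (t : R),
      [/\ U \is unitarymx, V \is unitarymx, admissible s t & generic s t] /\
      local_unitary U V (choi L) = canonical_state s t /\
      choi (rotate U V L) = canonical_state s t /\
      rotate U V L =1 kraus_map (kraus s t)) /\
  (* the same for a final state that already is in canonical representation *)
  (forall (L : {linear 'M[R[i]]_2 -> 'M[R[i]]_2}) (s : 'rV[R]_3) (t : R),
    nonunital_rank4_UQT L -> choi L = canonical_state s t ->
    admissible s t /\ (generic s t -> L =1 kraus_map (kraus s t))) /\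
  (* the properties of these Kraus operators *)
  (forall (s : 'rV[R]_3) (t : R), admissible s t -> generic s t ->
    [/\ forall k l : 'I_4, k != l ->
          \tr ((kraus s t k)^t* *m kraus s t l) = 0,
        \sum_k (kraus s t k)^t* *m kraus s t k = 1%:M,
        psd (choi (kraus_map (kraus s t))),
        completely_positive (kraus_map (kraus s t)) /\
          trace_preserving (kraus_map (kraus s t)) &
        \sum_k kraus s t k *m (kraus s t k)^t* <> 1%:M]).
Proof.
split; last split.
- move=> L uqt; have [U [V [s [t [uU uV adm gen luE]]]]] := uqt_canonical_form uqt.
  have linL : linear L by exact: linearP.
  have cE : choi (rotate U V L) = canonical_state s t by rewrite choi_rotate.
  exists U, V, s, t; split; first by split; [exact: uU|exact: uV|exact: adm|exact: gen].
  do 2! [split; first by []].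
  exact: kraus_of_canonical (rotate_linear U V linL) cE adm gen.
- move=> L s t uqt cL; have adm := canonical_channel_admissible uqt cL.
  split => // gen; apply: kraus_of_canonical cL adm gen; exact: linearP.
- move=> s t adm gen; have cp := kraus_map_cp (kraus s t).
  split; first exact: kraus_orthogonal.
  + exact: kraus_sum_adj.
  + exact: psd_choi.
  + by split => //; apply/kraus_map_tp/kraus_sum_adj.
  + exact: kraus_sum_mul_adj.
Qed.
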